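(* Let $C(u,v)$ be an absolutely continuous copula. Suppose there exist positive integers $s_1$ and $s_2$ such that some versions $c^{s_1}$, $c^{s_2}$ of the densities of $C^{s_1}$ and $C^{s_2}$ satisfy one of the following conditions: (1) there exists a constant $M\in\mathbb{R}$ such that $c^{s_1}(u,v)>0$ on a subset of $[0,1]^2$ of Lebesgue measure $1$ and $c^{s_2}(u,v)<M$ for all $(u,v)\in[0,1]^2$; (2) there is a constant $M\le 2$ such that $c^{s_2}(u,v)<M$ for all $(u,v)\in[0,1]^2$. Then $C$ generates $\psi$-mixing stationary Markov chains.
   Context: A (bivariate) copula is the restriction to $[0,1]^2$ of a bivariate cumulative distribution function with uniform marginals; it is absolutely continuous with density $c$ if $C(u,v)=\int_0^u\int_0^v c(s,t)\,dt\,ds$. A version of a function is any function equal to it off a set of Lebesgue measure $0$. The powers are $C^1=C$ and $C^n(u,v)=\int_0^1 C^{n-1}_{,2}(u,t)C_{,1}(t,v)\,dt$ for $n>1$, where $C_{,i}$ is the partial derivative in the $i$-th variable; $c^n$ denotes the density of $C^n$ (not a power of $c$). The stationary Markov chain $(U_n)_{n\ge0}$ generated by $C$ (and the uniform marginal) is the stationary Markov chain with $U_n$ uniform on $(0,1)$ such that $(U_n,U_{n+1})$ has joint distribution function $C$; then $(U_0,U_n)$ has distribution function $C^n$. The chain is $\psi$-mixing if $\psi_n\to0$, where $$\psi_n=\sup_{A,B:\,P(A)P(B)>0}\frac{|P^n(A\cap B)-P(A)P(B)|}{P(A)P(B)},$$ $A,B$ ranging over Borel sets, $P(A)=P(U_0\in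 A)$ and $P^n(A\cap B)=P(U_0\in A,\,U_n\in B)$. *)

(* Defs.v *)
From HB Require Import structures.
From mathcomp Require Import all_boot all_order all_algebra.
From mathcomp Require Import all_classical all_reals all_analysis.

Set Implicit Arguments.
Unset Strict Implicit.
Unset Printing Implicit Defensive.

Import Order.TTheory GRing.Theory Num.Theory.
Import numFieldNormedType.Exports.

Local Open Scope classical_set_scope.
Local Open Scope ring_scope.

(* A function on [0,1]^2 is represented by a total function R -> R -> R;
   its values outside the square are irrelevant (in copula_prod below they only
   enter at the endpoints t = 0 and t = 1, a null set). *)
Definition unit_square (R : realType) : set (R * R) := `[0, 1] `*` `[0, 1].
Arguments unit_square R : clear implicits.

Definition uniform01 (R : realType) : set R -> \bar R :=
  uniform_prob (@ltr01 R).

(* measurableTypeR R carries the same Borel sets as R, with the measure display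
   of lebesgue_measure, for which the Fubini lemmas are stated. *)
Definition leb2 (R : realType) :
    set (measurableTypeR R * measurableTypeR R) -> \bar R :=
  (@lebesgue_measure R \x @lebesgue_measure R)%E.

Definition is_copula (R : realType) (C : R -> R -> R) : Prop :=
  exists Q : probability (measurableTypeR R * measurableTypeR R)%type R,
    [/\ forall A : set R, measurable A -> Q (A `*` setT) = uniform01 A,
        forall B : set R, measurable B -> Q (setT `*` B) = uniform01 B &
        forall u v : R, u \in `[0, 1] -> v \in `[0, 1] ->
          (C u v)%:E = Q (`]-oo, u] `*` `]-oo, v])].

Definition is_density (R : realType) (C c : R -> R -> R) : Prop :=
  (@leb2 R).-integrable (unit_square R) (EFin \o uncurry c) /\
  forall u v : R, u \in `[0, 1] -> v \in `[0, 1] ->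
    ((C u v)%:E = \int[lebesgue_measure]_(s in `[0%R, u])
                   \int[lebesgue_measure]_(t in `[0%R, v]) (c s t)%:E)%E.

Definition abs_continuous (R : realType) (C : R -> R -> R) : Prop :=
  exists c, is_density C c.

(* A version may be an arbitrary function: it need not be Borel measurable. *)
Definition is_density_version (R : realType) (C c : R -> R -> R) : Prop :=
  exists2 c0, is_density C c0 &
    {ae @leb2 R, forall z, unit_square R z -> c z.1 z.2 = c0 z.1 z.2}.

Definition partial1 (R : realType) (C : R -> R -> R) (u v : R) : R :=
  derive1 (fun s => C s v) u.

Definition partial2 (R : realType) (C : R -> R -> R) (u v : R) : R :=
  derive1 (fun t => C u t) v.

Definition copula_prod (R : realType) (D C : R -> R -> R) (u v : R) : R :=
  \int[lebesgue_measure]_(t in `[0, 1]) (partial2 D u t * partial1 C t v).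

(* C^n for n >= 1; the value C at n = 0 is a dummy. *)
Definition copula_pow (R : realType) (C : R -> R -> R) (n : nat) : R -> R -> R :=
  iter n.-1 (fun D => copula_prod D C) C.

Section Chains.
Context (R : realType) (d : measure_display) (T : measurableType d).
Context (P : probability T R).

(* f is a version of the conditional probability P(A | G). *)
Definition is_cond_prob (G : set (set T)) (A : set T) (f : T -> R) : Prop :=
  [/\ forall B : set R, measurable B -> G (f @^-1` B),
      P.-integrable setT (EFin \o f) &
      forall E, G E -> (\int[P]_(x in E) (f x)%:E = P (A `&` E))%E].

Definition sigma_of (U : nat -> {RV P >-> R}) (I : set nat) : set (set T) :=
  <<s \bigcup_(i in I) preimage_set_system setT (U i) measurable >>.

(* P(U_{n+1} \in B | U_0, .., U_n) = P(U_{n+1} \in B | U_n) a.s. *)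
Definition is_markov (U : nat -> {RV P >-> R}) : Prop :=
  forall (n : nat) (B : set R), measurable B ->
  exists2 f : T -> R,
    is_cond_prob (sigma_of U [set n]) (U n.+1 @^-1` B) f &
    is_cond_prob (sigma_of U [set i | (i <= n)%N]) (U n.+1 @^-1` B) f.

Definition is_stationary (U : nat -> {RV P >-> R}) : Prop :=
  forall (n k : nat) (A : set (n.-tuple R)), measurable A ->
    P [set x | A [tuple U (k + i)%N x | i < n]] =
    P [set x | A [tuple U i x | i < n]].

Definition is_chain_of (C : R -> R -> R) (U : nat -> {RV P >-> R}) : Prop :=
  [/\ is_markov U, is_stationary U,
      forall (n : nat) (A : set R), measurable A ->
        distribution P (U n) A = uniform01 A &
      forall (n : nat) (u v : R), u \in `[0, 1] -> v \in `[0, 1] ->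
        P (U n @^-1` `]-oo, u] `&` U n.+1 @^-1` `]-oo, v]) = (C u v)%:E].

Definition psi_ratio (U : nat -> {RV P >-> R}) (n : nat) (A B : set R) : R :=
  let PA := fine (P (U 0%N @^-1` A)) in
  let PB := fine (P (U 0%N @^-1` B)) in
  `|fine (P (U 0%N @^-1` A `&` U n @^-1` B)) - PA * PB| / (PA * PB).

Definition psi_coef (U : nat -> {RV P >-> R}) (n : nat) : \bar R :=
  ereal_sup [set y | exists A B : set R,
    [/\ measurable A, measurable B,
        (0 < P (U 0%N @^-1` A) * P (U 0%N @^-1` B))%E &
        y = (psi_ratio U n A B)%:E]].

Definition psi_mixing (U : nat -> {RV P >-> R}) : Prop :=
  psi_coef U n @[n --> \oo] --> 0%E.

End Chains.

Definition generates_psi_mixing (R : realType) (C : R -> R -> R) : Prop :=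
  forall (d : measure_display) (T : measurableType d) (P : probability T R)
    (U : nat -> {RV P >-> R}), is_chain_of C U -> psi_mixing U.

(* Main.v *)
Require Import Defs.
From HB Require Import structures.
From mathcomp Require Import all_boot all_order all_algebra.
From mathcomp Require Import all_classical all_reals all_analysis.
From mathcomp Require Import measurable_realfun ring lra zify.

Set Implicit Arguments.
Unset Strict Implicit.
Unset Printing Implicit Defensive.

Import Order.TTheory GRing.Theory Num.Theory.
Import numFieldNormedType.Exports.

Local Open Scope classical_set_scope.
Local Open Scope ring_scope.
Local Open Scope ereal_scope.

(** The density of [C] can be chosen as a kernel [k] on [0,1] that is
    bistochastic at every point, not just almost everywhere (see [balance]).
    The kernel powers of [k] are then defined pointwise by Tonelli, they are
    densities of the copula powers (by Lebesgue differentiation) and they are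
    the joint densities of the chain (by the Markov property).

    If [k1 > 0] is a version of [c^s1] and [k2 <= M] one of [c^s2], the product
    [K = k2 k1 k2] is bounded below by a constant [e > 0]: each row and column
    of [k2] is a probability density bounded by [M], so it cannot concentrate on
    the small set where [k1] is close to 0.  Since [e <= K <= M], one
    multiplication by [K] contracts the range of a bistochastic kernel towards 1
    by the factor [1 - e]; hence the densities of [C^n] tend to 1 uniformly.

    If [k2 < 2], then [h = 2 - k2] is a positive bistochastic kernel with
    [h h = k2 k2], so [k2 k2 > 0] plays the role of [k1]. *)

(** * Kernels on a probability space *)

(** The recurring obstacle is almost-everywhere equality. Densities are determined only up to null
    sets, and a null set of the square can contain whole rows, whereas the bounds on products
    integrate along single rows and columns. Kernels are therefore compared by [keq], through their
    masses on rectangles: in this form copulas and chains deliver their laws, it is all that the psi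
    coefficient sees, and [kprod] respects it. Whenever a pointwise property is wanted, the kernel
    is replaced by a [keq] one that has it everywhere, the value 1 being written on the exceptional
    set; so the property must hold at 1, which for the upper bound means 1 < M. The base space is
    the whole line with the uniform law on [0,1] rather than the interval itself, so that kernels
    are total functions while constants still integrate to themselves. *)

Section Kernels.
Context {d : measure_display} {T : measurableType d} {R : realType}.
Variable m : probability T R.
Implicit Types (k l h : T -> T -> \bar R) (A B : set T).

(** Values are extended reals, so that products formed by Tonelli are kernels again without any
    finiteness condition. *)
Definition nnkernel k :=
  measurable_fun setT (fun z : T * T => k z.1 z.2) /\ forall x y, 0 <= k x y.

Lemma measurable_kernel_comp {d' : measure_display} {X : measurableType d'} k
    (f g : X -> T) : nnkernel k ->
  measurable_fun setT f -> measurable_fun setT g ->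
  measurable_fun setT (fun x => k (f x) (g x)).
Proof.
move=> [mk _] mf mg; apply: (measurableT_comp mk (g := fun x => (f x, g x))).
exact/measurable_fun_pairP.
Qed.

Lemma nnkernel_row k x : nnkernel k -> measurable_fun setT (k x).
Proof. by move=> nk; exact: measurable_kernel_comp. Qed.

Lemma nnkernel_col k y : nnkernel k -> measurable_fun setT (k ^~ y).
Proof. by move=> nk; exact: measurable_kernel_comp. Qed.

Lemma nnkernel_swap k : nnkernel k -> nnkernel (fun x y => k y x).
Proof.
move=> nk; split => [|x y]; last exact: nk.2.
exact: measurable_kernel_comp.
Qed.

(** Turns integrals over a rectangle into integrals over the whole space, where Tonelli is
    stated. *)
Lemma nnkernel_restrict k A B : nnkernel k -> measurable A -> measurable B ->
  nnkernel (fun x y => (\1_A x)%:E * k x y * (\1_B y)%:E).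
Proof.
move=> [mk k0] mA mB; split => [|x y]; last first.
  by rewrite !mule_ge0// lee_fin.
apply: emeasurable_funM; first apply: emeasurable_funM => //.
- apply/measurable_EFinP.
  exact: (measurableT_comp (measurable_indic mA) measurable_fst).
- apply/measurable_EFinP.
  exact: (measurableT_comp (measurable_indic mB) measurable_snd).
Qed.

Lemma integral_indicl (f : T -> \bar R) A :
  \int[m]_(x in A) f x = \int[m]_x ((\1_A x)%:E * f x).
Proof.
rewrite integral_mkcond; apply: eq_integral => x _.
by rewrite epatch_indic muleC.
Qed.

Lemma ge0_integralZlT (f : T -> \bar R) c : measurable_fun setT f ->
  (forall x, 0 <= f x) -> 0 <= c ->
  \int[m]_x (c * f x) = c * \int[m]_x f x.
Proof. by move=> mf f0 c0; exact: ge0_integralZl. Qed.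

Lemma measurable_row_integral k B : nnkernel k -> measurable B ->
  measurable_fun setT (fun x => \int[m]_(y in B) k x y).
Proof.
move=> nk mB; have [mk' k'0] := nnkernel_restrict nk measurableT mB.
have := measurable_fun_fubini_tonelli_F (m2 := m) _ mk'.
move=> /(_ (fun z => k'0 z.1 z.2)); apply: eq_measurable_fun => x _.
rewrite integral_indicl /fubini_F; apply: eq_integral => y _ /=.
by rewrite indicT mul1e muleC.
Qed.

Lemma measurable_col_integral k A : nnkernel k -> measurable A ->
  measurable_fun setT (fun y => \int[m]_(x in A) k x y).
Proof. by move=> /nnkernel_swap; exact: measurable_row_integral. Qed.

Lemma fubini_kernel k A B : nnkernel k -> measurable A -> measurable B ->
  \int[m]_(x in A) \int[m]_(y in B) k x y =
  \int[m]_(y in B) \int[m]_(x in A) k x y.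
Proof.
move=> nk mA mB; have [mk' k'0] := nnkernel_restrict nk mA mB.
have := fubini_tonelli (m1 := m) (m2 := m) _ mk' (fun z => k'0 z.1 z.2).
rewrite /= => E; rewrite [LHS]integral_indicl [RHS]integral_indicl.
transitivity (\int[m]_x \int[m]_y ((\1_A x)%:E * k x y * (\1_B y)%:E)).
  apply: eq_integral => x _; rewrite [in LHS]integral_indicl.
  rewrite -ge0_integralZlT; last 3 first.
  - apply: emeasurable_funM; first exact/measurable_EFinP.
    exact: nnkernel_row.
  - by move=> y; apply: mule_ge0; [rewrite lee_fin|exact: nk.2].
  - by rewrite lee_fin.
  by apply: eq_integral => y _; rewrite muleA [RHS]muleAC.
rewrite E; apply: eq_integral => y _; rewrite [in RHS]integral_indicl.
rewrite -ge0_integralZlT; last 3 first.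
- apply: emeasurable_funM; first exact/measurable_EFinP.
  exact: nnkernel_col.
- by move=> x; apply: mule_ge0; [rewrite lee_fin|exact: nk.2].
- by rewrite lee_fin.
by apply: eq_integral => x _; rewrite muleC.
Qed.

Definition kmass k A B : \bar R := \int[m]_(x in A) \int[m]_(y in B) k x y.

(** For bistochastic kernels this amounts to equality almost everywhere for the product measure,
    tested on rectangles only. *)
Definition keq k l := forall A B, measurable A -> measurable B ->
  kmass k A B = kmass l A B.

(** The Chapman-Kolmogorov composition, that is, the matrix product with a continuous index. *)
Definition kprod k l x y : \bar R := \int[m]_z (k x z * l z y).

Definition bistochastic k :=
  [/\ nnkernel k, forall x, \int[m]_y k x y = 1 & forall y, \int[m]_x k x y =
    1].

Lemma nnkernel_mul k l x y : nnkernel k -> nnkernel l ->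
  measurable_fun setT (fun z => k x z * l z y).
Proof.
move=> nk nl; apply: emeasurable_funM; first exact: nnkernel_row.
exact: nnkernel_col.
Qed.

Lemma nnkernel_mul_ge0 k l x y z : nnkernel k -> nnkernel l ->
  0 <= k x z * l z y.
Proof. by move=> [_ k0] [_ l0]; exact: mule_ge0. Qed.

Lemma nnkernel_prod k l : nnkernel k -> nnkernel l -> nnkernel (kprod k l).
Proof.
move=> nk nl; split => [|x y]; last first.
  by apply: integral_ge0 => z _; exact: nnkernel_mul_ge0.
pose f (w : (T * T) * T) := k w.1.1 w.2 * l w.2 w.1.2.
have mf : measurable_fun setT f.
  apply: emeasurable_funM; apply: measurable_kernel_comp => //.
    exact: (measurableT_comp measurable_fst measurable_fst).
  exact: (measurableT_comp measurable_snd measurable_fst).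
have := measurable_fun_fubini_tonelli_F (m2 := m) f mf
  (fun w => nnkernel_mul_ge0 _ _ _ nk nl).
by [].
Qed.

(** By Tonelli the left factor enters only through its column integrals over [A] and the right one
    only through its row integrals over [B]. This makes products compatible with [keq]; for rays [A]
    and [B] the two integrals are the partial derivatives in the definition of the copula
    product. *)
Lemma kmass_prod k l A B : nnkernel k -> nnkernel l ->
  measurable A -> measurable B ->
  kmass (kprod k l) A B =
  \int[m]_z ((\int[m]_(x in A) k x z) * (\int[m]_(y in B) l z y)).
Proof.
move=> nk nl mA mB.
have L0 z : 0 <= \int[m]_(y in B) l z y.
  by apply: integral_ge0 => y _; exact: nl.2.
have mL := measurable_row_integral nl mB.
transitivity (\int[m]_(x in A) \int[m]_z (k x z * \int[m]_(y in B) l z y)).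
  apply: eq_integral => x _; rewrite /kprod.
  rewrite (@fubini_kernel (fun y z => k x z * l z y) B setT)//; last first.
    split => [|y z]; last exact: nnkernel_mul_ge0.
    apply: emeasurable_funM; last exact: (nnkernel_swap nl).1.
    exact: (measurableT_comp (nnkernel_row x nk) measurable_snd).
  apply: eq_integral => z _; rewrite ge0_integralZl //.
  - apply: measurable_funTS; exact: nnkernel_row.
  - by move=> y _; exact: nl.2.
  - exact: nk.2.
rewrite (@fubini_kernel (fun x z => k x z * \int[m]_(y in B) l z y) A setT)//.
  apply: eq_integral => z _; rewrite ge0_integralZr//.
  - apply: measurable_funTS; exact: nnkernel_col.
  - by move=> x _; exact: nk.2.
split => [|x z]; last by rewrite mule_ge0//; exact: nk.2.
apply: emeasurable_funM; first exact: nk.1.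
exact: (measurableT_comp mL measurable_snd).
Qed.

Lemma kprodA k l h x y : nnkernel k -> nnkernel l -> nnkernel h ->
  kprod k (kprod l h) x y = kprod (kprod k l) h x y.
Proof.
move=> nk nl nh; rewrite /kprod.
transitivity (\int[m]_z \int[m]_w (k x z * l z w * h w y)).
  apply: eq_integral => z _; rewrite -ge0_integralZlT; last 3 first.
  - exact: nnkernel_mul.
  - by move=> w; exact: nnkernel_mul_ge0.
  - exact: nk.2.
  by apply: eq_integral => w _; rewrite muleA.
rewrite (@fubini_kernel (fun z w => k x z * l z w * h w y) setT setT)//.
  apply: eq_integral => w _; rewrite ge0_integralZr //.
  - exact: nnkernel_mul.
  - by move=> z _; exact: nnkernel_mul_ge0.
  - exact: nh.2.
split => [|z w]; last by rewrite mule_ge0//; [exact: nnkernel_mul_ge0|exact: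
  nh.2].
apply: emeasurable_funM; first apply: emeasurable_funM; last 2 first.
- exact: nl.1.
- exact: (measurableT_comp (nnkernel_col y nh) measurable_snd).
- exact: (measurableT_comp (nnkernel_row x nk) measurable_fst).
Qed.

Lemma bistochastic_swap k : bistochastic k -> bistochastic (fun x y => k y x).
Proof. by move=> [nk r c]; split => //; exact: nnkernel_swap. Qed.

Lemma kprod_row_integral k l x : bistochastic k -> bistochastic l ->
  \int[m]_y kprod k l x y = 1.
Proof.
move=> [nk rk _] [nl rl _]; rewrite /kprod.
rewrite (@fubini_kernel (fun y z => k x z * l z y) setT setT)//.
  rewrite -(rk x); apply: eq_integral => z _; rewrite ge0_integralZl ?rl
    ?mule1//.
  - exact: nnkernel_row.
  - by move=> y _; exact: nl.2.
  - exact: nk.2.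
split => [|y z]; last exact: nnkernel_mul_ge0.
apply: emeasurable_funM; last exact: (nnkernel_swap nl).1.
exact: (measurableT_comp (nnkernel_row x nk) measurable_snd).
Qed.

(** Transposition reverses products, so each statement about columns follows from the one about
    rows. *)
Lemma kprod_swap k l x y :
  kprod (fun x y => l y x) (fun x y => k y x) y x = kprod k l x y.
Proof. by apply: eq_integral => z _; rewrite muleC. Qed.

Lemma bistochastic_prod k l : bistochastic k -> bistochastic l ->
  bistochastic (kprod k l).
Proof.
move=> bk bl; have [nk _ _] := bk; have [nl _ _] := bl; split.
- exact: nnkernel_prod.
- by move=> x; exact: kprod_row_integral.
- move=> y; under eq_integral do rewrite -kprod_swap.
  by apply: kprod_row_integral; exact: bistochastic_swap.
Qed.

Lemma row_integral_le1 k x B : bistochastic k -> measurable B ->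
  \int[m]_(y in B) k x y <= 1.
Proof.
move=> [nk rk _] mB; rewrite -(rk x); apply: ge0_subset_integral => //.
- exact: nnkernel_row.
- by move=> y _; exact: nk.2.
Qed.

Lemma row_integral_ge0 k x B : nnkernel k -> 0 <= \int[m]_(y in B) k x y.
Proof. by move=> nk; apply: integral_ge0 => y _; exact: nk.2. Qed.

Lemma ge0_integral_ae_eq (f g : T -> \bar R) :
  measurable_fun setT f -> measurable_fun setT g ->
  (forall x, 0 <= f x) -> \int[m]_x f x < +oo ->
  (forall A, measurable A -> \int[m]_(x in A) f x = \int[m]_(x in A) g x) ->
  ae_eq m setT f g.
Proof.
move=> mf mg f0 foo fg; apply: integral_ae_eq => //.
- apply/integrableP; split => //.
  by under eq_integral do rewrite gee0_abs//.
- by move=> A _ mA; exact: fg.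
Qed.

(** For fixed [B], both sides are functions of x with the same integral over every [A]; being at
    most 1, they are integrable, hence equal almost everywhere. *)
Lemma keq_row_integral k l B : bistochastic k -> bistochastic l ->
  keq k l -> measurable B ->
  ae_eq m setT (fun x => \int[m]_(y in B) k x y)
               (fun x => \int[m]_(y in B) l x y).
Proof.
move=> bk bl kl mB; have [nk _ _] := bk; have [nl _ _] := bl.
apply: ge0_integral_ae_eq.
- exact: measurable_row_integral.
- exact: measurable_row_integral.
- by move=> x; exact: row_integral_ge0.
- rewrite (@le_lt_trans _ _ (\int[m]_x cst 1 x))//.
  + apply: ge0_le_integral => //.
    * by move=> x _; exact: row_integral_ge0.
    * exact: measurable_row_integral.
    * by move=> x _; exact: row_integral_le1.
  + by rewrite integral_cst// mul1e; exact: (le_lt_trans (probability_le1 m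
    measurableT) (ltry 1)).
- by move=> A mA; exact: kl.
Qed.

Lemma keq_swap k l : nnkernel k -> nnkernel l -> keq k l ->
  keq (fun x y => k y x) (fun x y => l y x).
Proof.
move=> nk nl kl A B mA mB; rewrite /kmass.
by rewrite -(fubini_kernel nk mB mA) -(fubini_kernel nl mB mA); exact: kl.
Qed.

Lemma keq_prod k k' l l' :
  bistochastic k -> bistochastic k' -> bistochastic l -> bistochastic l' ->
  keq k k' -> keq l l' -> keq (kprod k l) (kprod k' l').
Proof.
move=> bk bk' bl bl' kk' ll' A B mA mB.
have [nk _ _] := bk; have [nl _ _] := bl.
have [nk' _ _] := bk'; have [nl' _ _] := bl'.
rewrite (kmass_prod nk nl mA mB) (kmass_prod nk' nl' mA mB).
have H1 := @keq_row_integral _ _ A (bistochastic_swap bk) (bistochastic_swap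
  bk')
  (keq_swap nk nk' kk') mA.
have H2 := keq_row_integral bl bl' ll' mB.
apply: ge0_ae_eq_integral => //.
- apply: emeasurable_funM; last exact: measurable_row_integral.
  exact: measurable_col_integral.
- apply: emeasurable_funM; last exact: measurable_row_integral.
  exact: measurable_col_integral.
- move=> x _; apply: mule_ge0; last exact: row_integral_ge0.
  by apply: (@row_integral_ge0 (fun x y => k y x)); exact: nnkernel_swap.
- move=> x _; apply: mule_ge0; last exact: row_integral_ge0.
  by apply: (@row_integral_ge0 (fun x y => k' y x)); exact: nnkernel_swap.
- by apply: filterS2 H1 H2 => x H1 H2 Tx; rewrite H1// H2.
Qed.

Lemma keq_refl k : keq k k. Proof. by []. Qed.

Lemma keq_trans l k h : keq k l -> keq l h -> keq k h.
Proof. move=> kl lh A B mA mB; exact: (etrans (kl A B mA mB) (lh A B mA mB)).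
  Qed.

Definition kpow k n := iter n (kprod ^~ k) k.

Lemma bistochastic_pow k n : bistochastic k -> bistochastic (kpow k n).
Proof. by move=> bk; elim: n => //= n ih; exact: bistochastic_prod. Qed.

Lemma kpowS k n : kpow k n.+1 = kprod (kpow k n) k. Proof. by []. Qed.

(* [kpow k n] has [n.+1] factors. *)
Lemma kpow_add k i j : bistochastic k ->
  kprod (kpow k i) (kpow k j) = kpow k (i + j).+1.
Proof.
move=> bk; elim: j => [|j ih]; first by rewrite addn0.
rewrite addnS (kpowS k j) (kpowS k (i + j).+1) -ih.
have nn n : nnkernel (kpow k n) by have [] := bistochastic_pow n bk.
apply/funext => x; apply/funext => y.
by apply: kprodA; [exact: nn|exact: nn|exact: (nn 0%N)].
Qed.

(** Counting factors: (j + 1)(i + 1) = (j(i + 1) + i) + 1. *)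
Lemma kpow_mul k i j : bistochastic k ->
  kpow (kpow k i) j = kpow k (j * i.+1 + i).
Proof.
move=> bk; elim: j => [//|j ih]; rewrite kpowS ih kpow_add //.
by congr (kpow k _); rewrite mulSn; lia.
Qed.

Lemma keq_pow k l n : bistochastic k -> bistochastic l -> keq k l ->
  keq (kpow k n) (kpow l n).
Proof.
move=> bk bl kl; elim: n => [|n ih]; first exact: kl.
by apply: keq_prod; [exact: bistochastic_pow|exact: bistochastic_pow|
  exact: bk|exact: bl|exact: ih|exact: kl].
Qed.

End Kernels.

(** * Uniform convergence of kernel powers *)

Section KernelBounds.
Context {d : measure_display} {T : measurableType d} {R : realType}.
Variable m : probability T R.
Implicit Types (k l h : T -> T -> \bar R) (A B : set T).

Lemma integral_prob_cst (c : \bar R) : \int[m]_x c = c.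
Proof.
have -> : \int[m]_x c = c * m setT by exact: integral_cst.
by rewrite probability_setT mule1.
Qed.

(** The row [k x] is a probability density, so the product is a weighted average of the column of
    [l] at y and inherits its bounds. *)
Lemma kprod_le k l (b : R) x y : bistochastic m k -> nnkernel l ->
  (forall z, l z y <= b%:E) -> kprod m k l x y <= b%:E.
Proof.
move=> [nk rk _] nl lb.
have b0 : 0 <= b%:E := le_trans (nl.2 x y) (lb x).
have <- : \int[m]_z (b%:E * k x z) = b%:E.
  rewrite ge0_integralZlT; first by rewrite rk mule1.
  - exact: nnkernel_row.
  - by move=> z; exact: nk.2.
  - exact: b0.
apply: ge0_le_integral => //.
- by move=> z _; exact: nnkernel_mul_ge0.
- exact: nnkernel_mul.
- apply: measurable_funeM; exact: nnkernel_row.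
- by move=> z _; rewrite muleC lee_wpmul2r//; exact: nk.2.
Qed.

Lemma kprod_ge k l (a : R) x y : bistochastic m k -> nnkernel l ->
  (0 <= a)%R -> (forall z, a%:E <= l z y) -> a%:E <= kprod m k l x y.
Proof.
move=> [nk rk _] nl a0 la.
have {1}<- : \int[m]_z (a%:E * k x z) = a%:E.
  rewrite ge0_integralZlT; first by rewrite rk mule1.
  - exact: nnkernel_row.
  - by move=> z; exact: nk.2.
  - by rewrite lee_fin.
apply: ge0_le_integral => //.
- by move=> z _; rewrite mule_ge0//; exact: nk.2.
- apply: measurable_funeM; exact: nnkernel_row.
- exact: nnkernel_mul.
- by move=> z _; rewrite muleC lee_wpmul2l//; exact: nk.2.
Qed.

Lemma fin_between (a b : R) (u : \bar R) : a%:E <= u <= b%:E ->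
  exists2 r, u = r%:E & (a <= r <= b)%R.
Proof.
case: u => [r| |]; [by rewrite !lee_fin; exists r| |].
- by rewrite leye_eq andbF.
- by rewrite leeNy_eq.
Qed.

(** This is (u - e)(b - v) >= 0, rearranged so that no extended real is subtracted. *)
Lemma contraction_le (e a b M : R) (u v : \bar R) :
  e%:E <= u <= M%:E -> a%:E <= v <= b%:E ->
  u * v + (e * b)%:E <= b%:E * u + e%:E * v.
Proof.
move=> /fin_between[r -> /andP[? ?]] /fin_between[s -> /andP[? ?]].
by rewrite lee_fin; nra.
Qed.

(** This is (u - e)(v - a) >= 0, rearranged in the same way. *)
Lemma contraction_ge (e a b M : R) (u v : \bar R) :
  e%:E <= u <= M%:E -> a%:E <= v <= b%:E ->
  a%:E * u + e%:E * v <= u * v + (e * a)%:E.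
Proof.
move=> /fin_between[r -> /andP[? ?]] /fin_between[s -> /andP[? ?]].
by rewrite lee_fin; nra.
Qed.

(** Morally k = e + (1 - e)k' with k' stochastic: the constant part integrates the column of [l] to
    1, the rest averages it. The proof avoids dividing by 1 - e by integrating the two contraction
    inequalities. *)
Lemma kprod_contract k l (e M a b : R) x y : bistochastic m k -> bistochastic m
  l ->
  (0 <= e)%R -> (0 <= a)%R ->
  (forall x y, e%:E <= k x y <= M%:E) -> (forall x y, a%:E <= l x y <= b%:E) ->
  (e + (1 - e) * a)%:E <= kprod m k l x y <= (e + (1 - e) * b)%:E.
Proof.
move=> bk bl e0 a0 kM lb.
have [nk rk _] := bk; have [nl _ cl] := bl.
have b0 : (0 <= b)%R.
  by have /andP[+ /(le_trans _)h] := lb x y => /h; rewrite lee_fin; lra.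
have mkl : measurable_fun setT (fun z => k x z * l z y) by exact: nnkernel_mul.
have mk : measurable_fun setT (k x) by exact: nnkernel_row.
have ml : measurable_fun setT (l ^~ y) by exact: nnkernel_col.
have k0 z : 0 <= k x z by exact: nk.2.
have l0 z : 0 <= l z y by exact: nl.2.
have kl0 z : 0 <= k x z * l z y by exact: mule_ge0.
have lin (c : R) : (0 <= c)%R ->
    \int[m]_z (c%:E * k x z + e%:E * l z y) = c%:E + e%:E.
  move=> c0; rewrite ge0_integralD; last 5 first.
  - exact: measurableT.
  - by move=> z _; rewrite mule_ge0// lee_fin.
  - exact: measurable_funeM.
  - by move=> z _; rewrite mule_ge0// lee_fin.
  - exact: measurable_funeM.
  rewrite !ge0_integralZlT ?lee_fin//.
  by rewrite rk cl !mule1.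
have quad (c : R) : (0 <= c)%R ->
    \int[m]_z (k x z * l z y + (e * c)%:E) = kprod m k l x y + (e * c)%:E.
  move=> c0; rewrite ge0_integralD; last 5 first.
  - exact: measurableT.
  - by move=> z _; exact: kl0.
  - exact: mkl.
  - by move=> z _; rewrite lee_fin mulr_ge0.
  - exact: measurable_cst.
  by rewrite integral_prob_cst.
have mlin (c : R) : measurable_fun setT (fun z => c%:E * k x z + e%:E * l z y).
  by apply: emeasurable_funD; exact: measurable_funeM.
have mquad (c : R) : measurable_fun setT (fun z => k x z * l z y + (e * c)%:E).
  exact: emeasurable_funD.
have up : kprod m k l x y + (e * b)%:E <= b%:E + e%:E.
  rewrite -quad// -lin//; apply: ge0_le_integral => //.
  - by move=> z _; rewrite adde_ge0// lee_fin mulr_ge0.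
  - by move=> z _; exact: contraction_le (kM x z) (lb z y).
have lo : a%:E + e%:E <= kprod m k l x y + (e * a)%:E.
  rewrite -quad// -lin//; apply: ge0_le_integral => //.
  - by move=> z _; rewrite adde_ge0// mule_ge0// lee_fin.
  - by move=> z _; exact: contraction_ge (kM x z) (lb z y).
move: up lo; case: (kprod m k l x y) => [u| |] //.
by rewrite !lee_fin => ? ?; apply/andP; split; nra.
Qed.

End KernelBounds.

(** * Strict positivity, uniform lower bounds and geometric convergence *)

Section Mixing.
Context {d : measure_display} {T : measurableType d} {R : realType}.
Variable m : probability T R.
Implicit Types (k l h : T -> T -> \bar R) (A B : set T).

(** The map t -> e + (1 - e)t fixes 1 and contracts towards it. At n = 0 the bounds are 0 and 1 + M,
    weaker than the hypothesis on [k]. *)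
Lemma kpow_between k (e M : R) n x y : bistochastic m k ->
  (0 <= e)%R -> (e <= 1)%R -> (forall x y, e%:E <= k x y <= M%:E) ->
  (1 - (1 - e) ^+ n)%:E <= kpow m k n x y <= (1 + (1 - e) ^+ n * M)%:E.
Proof.
move=> bk e0 e1 kM; elim: n x y => [|n ih] x y.
  rewrite expr0 subrr mul1r /=; have /andP[ek kM'] := kM x y.
  apply/andP; split; first by apply: le_trans ek; rewrite lee_fin.
  by apply: le_trans kM' _; rewrite lee_fin lerDr.
have en0 : (0 <= (1 - e) ^+ n)%R by rewrite exprn_ge0// subr_ge0.
have en1 : ((1 - e) ^+ n <= 1)%R.
  by rewrite exprn_ile1// ?subr_ge0// lerBlDr lerDl.
have := @kprod_contract _ _ _ m k (kpow m k n) e M (1 - (1 - e) ^+ n)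
  (1 + (1 - e) ^+ n * M) x y bk (bistochastic_pow n bk) e0 _ kM ih.
rewrite subr_ge0 => /(_ en1).
(* The contraction puts the new factor on the left, whereas [kpow] appends it on the right;
   associativity reconciles them. *)
rewrite -[kprod m k _]/(kprod m (kpow m k 0) _) kpow_add// add0n exprS.
move=> /andP[lo up]; apply/andP; split.
- by apply: le_trans lo; rewrite lee_fin; lra.
- by apply: le_trans up _; rewrite lee_fin; lra.
Qed.

(** If the integral vanished, f would be 0 almost everywhere; the exceptional null set would then be
    the whole space, which has mass 1. *)
Lemma integral_gt0 (f : T -> \bar R) : measurable_fun setT f ->
  (forall x, 0 < f x) -> 0 < \int[m]_x f x.
Proof.
move=> mf f0; rewrite lt0e integral_ge0 ?andbT; last first.
  by move=> x _; exact: ltW.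
apply/eqP => If0.
have [+ _] := ae_eq_integral_abs m measurableT mf.
have -> : \int[m]_x `|f x| = 0.
  by rewrite -[RHS]If0; apply: eq_integral => x _; rewrite gee0_abs// ltW.
move=> /(_ erefl) [N [mN mN0 fN]].
have NT : N = setT.
  apply/seteqP; split => // x _; apply: fN => /= /(_ Logic.I) fx0.
  by have := f0 x; rewrite fx0 ltxx.
have : 1 = 0 :> \bar R by rewrite -(probability_setT m) -NT; exact: mN0.
by move=> /eqP; rewrite eqe oner_eq0.
Qed.

Lemma complement_product k x y : bistochastic m k ->
  (forall x y, k x y < 2%:E) -> 0 < kprod m k k x y.
Proof.
move=> bk k2; have [nk rk ck] := bk.
pose h x y := 2%:E - k x y.
have kfin x' y' : exists2 r, k x' y' = r%:E & (0 <= r < 2)%R.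
  have := nk.2 x' y'; have := k2 x' y'; case: (k x' y') => [r| |] //.
  by rewrite lte_fin lee_fin => ? ?; exists r => //; apply/andP.
have h0 x' y' : 0 < h x' y'.
  by rewrite /h; have [r -> /andP[_ ?]] := kfin x' y'; rewrite lte_fin subr_gt0.
have nh : nnkernel h.
  split => [|x' y']; last exact: ltW.
  by apply: emeasurable_funB => //; exact: nk.1.
(* A row or column of [h] has integral 2 - 1; [f] is added back rather than subtracting integrals in
   the extended reals. *)
have row1 (f : T -> \bar R) : measurable_fun setT f -> (forall z, 0 <= f z) ->
    (forall z, exists2 r, f z = r%:E & (0 <= r < 2)%R) ->
    \int[m]_z f z = 1 -> \int[m]_z (2%:E - f z) = 1.
  move=> mf f0 ffin f1.
  have : \int[m]_z ((2%:E - f z) + f z) = 2%:E.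
    rewrite -[RHS](integral_prob_cst m); apply: eq_integral => z _.
    by have [r -> _] := ffin z; rewrite -EFinB -EFinD subrK.
  rewrite ge0_integralD; last 5 first.
  - exact: measurableT.
  - move=> z _; have [r -> /andP[_ ?]] := ffin z.
    by rewrite lee_fin subr_ge0 ltW.
  - exact: emeasurable_funB.
  - by move=> z _.
  - exact: mf.
  rewrite f1; case: (\int[m]_z _) => [r| |] //= [r1]; congr (_%:E).
  by apply: (addIr 1%R); rewrite r1; lra.
have rh x' : \int[m]_z h x' z = 1.
  by apply: row1 (rk x') => //; [exact: nnkernel_row|exact: nk.2 x'].
have ch y' : \int[m]_z h z y' = 1.
  by apply: row1 (ck y') => //; [exact: nnkernel_col|move=> z; exact: nk.2].
have mkk : measurable_fun setT (fun z => k x z * k z y) by exact: nnkernel_mul.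
have mhh : measurable_fun setT (fun z => h x z * h z y) by exact: nnkernel_mul.
have mhx : measurable_fun setT (h x) by exact: nnkernel_row.
have mhy : measurable_fun setT (h ^~ y) by exact: nnkernel_col.
have hh0 : 0 < kprod m h h x y.
  by apply: integral_gt0 => // z; rewrite mule_gt0.
(* With h = 2 - k, the identity (2 - h)(2 - h') = 4 - 2h - 2h' + hh' and the
   normalisations of h give kprod k k = kprod h h. *)
have : \int[m]_z (k x z * k z y + (2%:E * h x z + 2%:E * h z y)) =
       \int[m]_z (h x z * h z y + 4%:E).
  apply: eq_integral => z _; rewrite /h.
  have [r -> _] := kfin x z; have [s -> _] := kfin z y.
  rewrite -!EFinB -!EFinM -!EFinD; congr (_%:E); ring.
rewrite ge0_integralD; last 5 first.
- exact: measurableT.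
- by move=> z _; exact: nnkernel_mul_ge0.
- exact: mkk.
- by move=> z _; rewrite adde_ge0// mule_ge0// ?lee_fin// ltW.
- by apply: emeasurable_funD; exact: measurable_funeM.
rewrite ge0_integralD; last 5 first.
- exact: measurableT.
- by move=> z _; rewrite mule_ge0// ?lee_fin// ltW.
- exact: measurable_funeM.
- by move=> z _; rewrite mule_ge0// ?lee_fin// ltW.
- exact: measurable_funeM.
rewrite ge0_integralD; last 5 first.
- exact: measurableT.
- by move=> z _; exact: nnkernel_mul_ge0.
- exact: mhh.
- by move=> z _; rewrite lee_fin.
- exact: measurable_cst.
rewrite (ge0_integralZlT m mhx (nh.2 x)) ?lee_fin//.
rewrite (ge0_integralZlT m mhy (fun z => nh.2 z y)) ?lee_fin//.
rewrite rh ch !mule1 integral_prob_cst -/(kprod m k k x y) -/(kprod m h h x y).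
move: hh0; case: (kprod m h h x y) => [r| |] //; case: (kprod m k k x y) => [s|
  |] //.
by rewrite !lte_fin => r0 [] ?; lra.
Qed.

(** Off the set S where k1 < del, the triple product is at least del times the mass of k2(x,a)
    k2(b,y), which is at least 1 - M^2 |S|. A factor [k2] is needed on each side: S is small only in
    product measure and may contain whole rows or columns. *)
Lemma minorize k1 k2 (M : R) : bistochastic m k1 -> bistochastic m k2 ->
  (0 < M)%R -> (forall x y, 0 < k1 x y) -> (forall x y, k2 x y <= M%:E) ->
  exists2 e : R, (0 < e)%R &
    forall x y, e%:E <= kprod m k2 (kprod m k1 k2) x y.
Proof.
move=> [nk1 _ _] [nk2 rk2 ck2] M0 k10 k2M.
pose S n := [set z : T * T | k1 z.1 z.2 < (n.+1%:R^-1)%:E].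
have mS n : measurable (S n).
  rewrite -[S n]setTI; apply: emeasurable_fun_infty_o => //.
  exact: nk1.1.
have ndS : nonincreasing_seq S.
  apply/nonincreasing_seqP => n; apply/subsetPset => z /= Sz.
  by apply: lt_le_trans Sz _; rewrite lee_fin lef_pV2 ?posrE// ler_nat.
have S0 : \bigcap_n S n = set0.
  apply/seteqP; split => // z Sz; have := k10 z.1 z.2.
  have := Sz 0%N Logic.I; rewrite /S /=.
  case E : (k1 z.1 z.2) => [r| |] // _; rewrite lte_fin => r0.
  have [n nr] := ltr_add_invr r0; have := Sz n Logic.I.
  by rewrite /S /= E lte_fin; move: nr; rewrite add0r => /ltW; rewrite leNgt =>
    /negP.
have cvgS : (m \x m) (S n) @[n --> \oo] --> 0.
  have -> : 0 = (m \x m) (\bigcap_n S n) by rewrite S0 measure0.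
  apply: nonincreasing_cvg_mu => //.
  - exact: (le_lt_trans (probability_le1 (m \x m) (mS 0%N)) (ltry 1)).
  - by rewrite S0.
(* Chosen so that the total loss del * M^2 * eta equals del / 2. *)
pose eta : R := ((2 * M ^+ 2)^-1)%R.
have eta0 : (0 < eta)%R by rewrite invr_gt0 mulr_gt0// exprn_gt0.
have [n Sn] : exists n, (m \x m) (S n) < eta%:E.
  have : nbhs (0 : \bar R) [set y | y < eta%:E].
    by apply: open_nbhs_nbhs; split; [exact: open_ereal_lt_ereal|rewrite /=
      lte_fin].
  move=> /cvgS; rewrite /nbhs /=.
  by case => n _ /(_ n (leqnn n)) ?; exists n.
pose del : R := (n.+1%:R^-1)%R.
have del0 : (0 < del)%R by rewrite invr_gt0.
pose phi a b : \bar R := (\1_(S n) (a, b))%:E.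
have nphi : nnkernel phi.
  split => [|a b]; last by rewrite lee_fin.
  apply/measurable_EFinP.
  rewrite (_ : (fun _ => _) = \1_(S n)); first exact: measurable_indic.
  by apply/funext => -[].
pose Phi a := \int[m]_b phi a b.
have mPhi : measurable_fun setT Phi by exact: measurable_row_integral.
have Phi0 a : 0 <= Phi a by apply: integral_ge0 => b _; exact: nphi.2.
have IPhi : \int[m]_a Phi a <= eta%:E.
  apply: le_trans (ltW Sn).
  have := @indic_fubini_tonelli1 _ _ _ _ _ m m (S n) (mS n).
  by rewrite integral_indic// setIT => ->.
exists (del / 2)%R; first by rewrite divr_gt0.
move=> x y.
(* The column of [k2] at y is averaged in b; the loss at a is controlled by [Phi a], the measure of
   the section of [S n] at a. Losses stay on the right as added terms. *)
have step1 a : del%:E <= kprod m k1 k2 a y + (del * M)%:E * Phi a.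
  have {1}<- : \int[m]_b (del%:E * k2 b y) = del%:E.
    rewrite ge0_integralZlT; first by rewrite ck2 mule1.
    - exact: nnkernel_col.
    - by move=> b; exact: nk2.2.
    - by rewrite lee_fin ltW.
  have mphi : measurable_fun setT (phi a) by exact: nnkernel_row.
  rewrite -(ge0_integralZlT m mphi (nphi.2 a)); last first.
    by rewrite lee_fin mulr_ge0// ltW.
  rewrite -ge0_integralD; last 5 first.
  - exact: measurableT.
  - by move=> b _; exact: nnkernel_mul_ge0.
  - exact: nnkernel_mul.
  - move=> b _; apply: mule_ge0; last exact: nphi.2.
    by rewrite lee_fin mulr_ge0// ltW.
  - exact: measurable_funeM.
  apply: ge0_le_integral => //.
  - by move=> b _; apply: mule_ge0; [rewrite lee_fin ltW|exact: nk2.2].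
  - by apply: measurable_funeM; exact: nnkernel_col.
  - apply: emeasurable_funD; first exact: nnkernel_mul.
    exact: measurable_funeM.
  - move=> b _; rewrite /phi indicE.
    have [Sab|/negP Sab] := boolP ((a, b) \in S n).
    + rewrite mule1 EFinM; apply: le_trans (lee_wpmul2l _ (k2M b y)) _.
        by rewrite lee_fin ltW.
      by rewrite leeDr//; exact: nnkernel_mul_ge0.
    + rewrite mule0 adde0; apply: lee_wpmul2r; first exact: nk2.2.
      by rewrite leNgt; apply/negP => ?; apply: Sab; rewrite inE.
have mG : measurable_fun setT (fun a => kprod m k1 k2 a y).
  exact: nnkernel_col (nnkernel_prod m nk1 nk2).
have G0 a : 0 <= kprod m k1 k2 a y by exact: (nnkernel_prod m nk1 nk2).2.
have mk2x : measurable_fun setT (k2 x) by exact: nnkernel_row.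
(* Averaging [step1] over a with weights [k2 x a], at most M, replaces the section measure by its
   integral. *)
have : del%:E <= kprod m k2 (kprod m k1 k2) x y + (del * M ^+ 2)%:E * \int[m]_a
  Phi a.
  have {1}<- : \int[m]_a (del%:E * k2 x a) = del%:E.
    rewrite (ge0_integralZlT m mk2x (nk2.2 x)); first by rewrite rk2 mule1.
    by rewrite lee_fin ltW.
  rewrite -(ge0_integralZlT m mPhi Phi0); last first.
    by rewrite lee_fin mulr_ge0// ?ltW// exprn_gt0.
  have c0 : 0 <= (del * M ^+ 2)%:E.
    by rewrite lee_fin mulr_ge0// ?ltW// exprn_gt0.
  rewrite -ge0_integralD; last 5 first.
  - exact: measurableT.
  - by move=> a _; rewrite mule_ge0//; exact: nk2.2.
  - exact: emeasurable_funM.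
  - by move=> a _; exact: mule_ge0.
  - exact: measurable_funeM.
  apply: ge0_le_integral => //.
  - by move=> b _; apply: mule_ge0; [rewrite lee_fin ltW|exact: nk2.2].
  - exact: measurable_funeM.
  - apply: emeasurable_funD; first exact: emeasurable_funM.
    exact: measurable_funeM.
  - move=> a _; rewrite muleC.
    apply: le_trans (lee_wpmul2l (nk2.2 x a) (step1 a)) _.
    have dM0 : 0 <= (del * M)%:E * Phi a.
      by rewrite mule_ge0// lee_fin mulr_ge0// ltW.
    rewrite ge0_muleDr// leeD2l//.
    apply: le_trans (lee_wpmul2r dM0 (k2M x a)) _.
    by rewrite muleA -EFinM expr2 mulrCA.
have /fin_between[s -> /andP[s0 se]] : 0%:E <= \int[m]_a Phi a <= eta%:E.
  by rewrite IPhi andbT; apply: integral_ge0 => a _.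
have : 0 <= kprod m k2 (kprod m k1 k2) x y.
  by apply: integral_ge0 => a _; rewrite mule_ge0//; exact: nk2.2.
case: (kprod _ _ _ _ _) => [r r0| _ _|//]; last by rewrite leey.
rewrite -EFinM -EFinD !lee_fin => dr.
have : (del * M ^+ 2 * s <= del / 2)%R.
  apply: le_trans (ler_wpM2l _ se) _; first by rewrite mulr_ge0// ?ltW//
    exprn_gt0.
  by rewrite /eta le_eqVlt; apply/orP; left; apply/eqP; field; rewrite gt_eqF.
lra.
Qed.

End Mixing.

(** * Exact normalisation of kernels, and mixing of their powers *)

Section Balance.
Context {d : measure_display} {T : measurableType d} {R : realType}.
Variable m : probability T R.
Implicit Types (k l g : T -> T -> \bar R) (A B : set T).

Lemma integral_in_cst (c : \bar R) A : measurable A ->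
  \int[m]_(x in A) c = c * m A.
Proof. by move=> mA; exact: integral_cst. Qed.

Definition unimarginal g := forall A, measurable A ->
  kmass m g A setT = m A /\ kmass m g setT A = m A.

Lemma unimarginal_swap g : nnkernel g -> unimarginal g ->
  unimarginal (fun x y => g y x).
Proof.
move=> ng ug A mA; have [u1 u2] := ug A mA.
rewrite /kmass -(fubini_kernel m ng measurableT mA).
by rewrite -(fubini_kernel m ng mA measurableT).
Qed.

Lemma bistochastic_unimarginal k : bistochastic m k -> unimarginal k.
Proof.
move=> [nk rk ck] A mA; rewrite /kmass (fubini_kernel m nk measurableT mA).
split; under eq_integral do rewrite ?rk ?ck.
  by rewrite integral_in_cst// mul1e.
by rewrite integral_in_cst// mul1e.
Qed.

Lemma keq_unimarginal k g : keq m k g -> unimarginal k -> unimarginal g.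
Proof.
by move=> kg uk A mA; rewrite -(kg _ _ mA measurableT) -(kg _ _ measurableT mA);
  exact: uk.
Qed.

(** A row with wrong integral becomes constantly 1. A good row changes only at the bad columns,
    which form a null set when the marginals are uniform, so its integral survives. Columns are
    symmetric, whence exact normalisation everywhere. *)
Definition balance g x y : \bar R :=
  if (\int[m]_t g x t == 1) && (\int[m]_t g t y == 1) then g x y else 1.

Lemma nnkernel_balance g : nnkernel g -> nnkernel (balance g).
Proof.
move=> ng; split => [|x y]; last first.
  by rewrite /balance; case: ifP => // _; exact: ng.2.
rewrite /balance; apply: measurable_fun_ifT => //; last exact: ng.1.
apply: measurable_and; apply: measurable_fun_eqe => //.
- have mr := measurable_row_integral m ng measurableT.
  exact: (measurableT_comp mr measurable_fst).
- have mc := measurable_col_integral m ng measurableT.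
  exact: (measurableT_comp mc measurable_snd).
Qed.

Lemma balance_swap g x y :
  balance (fun x y => g y x) x y = balance g y x.
Proof. by rewrite /balance andbC. Qed.

Lemma ae_row_integral1 g : nnkernel g -> unimarginal g ->
  ae_eq m setT (fun x => \int[m]_y g x y) (cst 1).
Proof.
move=> ng ug; apply: ge0_integral_ae_eq.
- exact: measurable_row_integral.
- exact: measurable_cst.
- by move=> x; exact: row_integral_ge0.
- have [+ _] := ug setT measurableT; rewrite /kmass => ->.
  exact: (le_lt_trans (probability_le1 m measurableT) (ltry 1)).
- by move=> A mA; rewrite integral_in_cst// mul1e; have [] := ug A mA.
Qed.

Lemma balance_row_integral g x B : nnkernel g -> unimarginal g ->
  measurable B -> \int[m]_t g x t = 1 ->
  \int[m]_(y in B) balance g x y = \int[m]_(y in B) g x y.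
Proof.
move=> ng ug mB gx1.
have H := ae_row_integral1 (nnkernel_swap ng) (unimarginal_swap ng ug).
apply: ge0_ae_eq_integral => //.
- apply: measurable_funTS; exact: nnkernel_row (nnkernel_balance ng).
- apply: measurable_funTS; exact: nnkernel_row.
- by move=> y _; exact: (nnkernel_balance ng).2.
- by move=> y _; exact: ng.2.
- apply: filterS H => y /(_ Logic.I) /= gy1 _.
  by rewrite /balance gx1 gy1 eqxx.
Qed.

Lemma balance_row1 g x : nnkernel g -> unimarginal g ->
  \int[m]_y balance g x y = 1.
Proof.
move=> ng ug; have [gx1|gx1] := eqVneq (\int[m]_t g x t) 1.
  by rewrite (balance_row_integral ng ug measurableT gx1).
rewrite -[RHS](integral_prob_cst m); apply: eq_integral => y _.
by rewrite /balance (negbTE gx1).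
Qed.

Lemma bistochastic_balance g : nnkernel g -> unimarginal g ->
  bistochastic m (balance g).
Proof.
move=> ng ug; split.
- exact: nnkernel_balance.
- by move=> x; exact: balance_row1 ng ug.
- move=> y; under eq_integral do rewrite -balance_swap.
  exact: balance_row1 (nnkernel_swap ng) (unimarginal_swap ng ug).
Qed.

Lemma keq_balance g : nnkernel g -> unimarginal g -> keq m g (balance g).
Proof.
move=> ng ug A B mA mB; apply: ge0_ae_eq_integral => //.
- apply: measurable_funTS; exact: measurable_row_integral.
- apply: measurable_funTS; apply: measurable_row_integral => //.
  exact: nnkernel_balance.
- by move=> x _; exact: row_integral_ge0.
- by move=> x _; apply: row_integral_ge0; exact: nnkernel_balance.
- apply: filterS (ae_row_integral1 ng ug) => x /(_ Logic.I) /= gx1 _.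
  by rewrite (balance_row_integral ng ug mB gx1).
Qed.

Lemma kmass_between k (a b : R) A B : nnkernel k -> (0 <= a)%R ->
  (forall x y, a%:E <= k x y <= b%:E) -> measurable A -> measurable B ->
  a%:E * (m A * m B) <= kmass m k A B <= b%:E * (m A * m B).
Proof.
move=> nk a0 kab mA mB.
have mk x : measurable_fun B (k x).
  by apply: measurable_funTS; exact: nnkernel_row.
have mr : measurable_fun A (fun x => \int[m]_(y in B) k x y).
  by apply: measurable_funTS; exact: measurable_row_integral.
have E c : c * (m A * m B) = \int[m]_(x in A) (c * m B).
  by rewrite integral_in_cst// muleAC muleA.
rewrite !E; apply/andP; split; apply: ge0_le_integral => //.
- by move=> x _; rewrite mule_ge0// lee_fin.
- move=> x _; rewrite -integral_in_cst//; apply: ge0_le_integral => //.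
  by move=> y _; have /andP[] := kab x y.
- by move=> x _; exact: row_integral_ge0.
- move=> x _; rewrite -integral_in_cst//; apply: ge0_le_integral => //.
  + by move=> y _; exact: nk.2.
  + by move=> y _; have /andP[] := kab x y.
Qed.

Theorem kpow_mixing k k1 k2 i j (M : R) :
  bistochastic m k -> bistochastic m k1 -> bistochastic m k2 ->
  (forall x y, 0 < k1 x y) -> (forall x y, k2 x y <= M%:E) ->
  keq m (kpow m k i) k1 -> keq m (kpow m k j) k2 ->
  forall eps : R, (0 < eps)%R -> exists N, forall n, (N <= n)%N ->
  forall A B, measurable A -> measurable B ->
  (1 - eps)%:E * (m A * m B) <= kmass m (kpow m k n) A B <=
  (1 + eps)%:E * (m A * m B).
Proof.
move=> bk bk1 bk2 k10 k2M0 kk1 kk2 eps eps0.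
(* With M' >= 1, the single condition (1 - e)^q * M' <= eps controls both the upper and the lower
   bound. *)
pose M' := Num.max M 1%R.
have M'1 : (1 <= M')%R by rewrite le_max lexx orbT.
have M'0 : (0 < M')%R by exact: lt_le_trans M'1.
have k2M x y : k2 x y <= M'%:E.
  by apply: le_trans (k2M0 x y) _; rewrite lee_fin le_max lexx.
have [e0 e00 eK0] := minorize bk1 bk2 M'0 k10 k2M.
(* The cap keeps [1 - e] in [0, 1). *)
pose e := Num.min e0 1%R.
have e_gt0 : (0 < e)%R by rewrite lt_min e00 ltr01.
have e_le1 : (e <= 1)%R by rewrite ge_min lexx orbT.
pose K := kprod m k2 (kprod m k1 k2).
have bk12 : bistochastic m (kprod m k1 k2) by exact: bistochastic_prod.
have bK : bistochastic m K by exact: bistochastic_prod.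
have [nk2 _ _] := bk2; have [nk12 _ _] := bk12.
have KM x y : e%:E <= K x y <= M'%:E.
  apply/andP; split.
    by apply: le_trans (eK0 x y); rewrite lee_fin ge_min lexx.
  by apply: kprod_le => // z; exact: kprod_le.
(* [L.+1] = (j + 1) + (i + 1) + (j + 1) is the number of factors [k] represented by [K]. *)
pose L := (j + (i + j).+1).+1.
have kK : keq m (kpow m k L) K.
  rewrite /L -(kpow_add j (i + j).+1 bk) -(kpow_add i j bk).
  have bp n := bistochastic_pow n bk.
  apply: (keq_prod (bp j) bk2 (bistochastic_prod (bp i) (bp j)) bk12 kk2).
  exact: (keq_prod (bp i) bk1 (bp j) bk2 kk1 kk2).
have [q qeps] : exists q, ((1 - e) ^+ q < eps / M')%R.
  have : ((fun q => (1 - e) ^+ q)%R : nat -> R) @ \oo --> (0 : R)%R.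
    by apply: cvg_expr; rewrite ger0_norm ?subr_ge0// ltrBlDr ltrDl.
  have eM : (0 < eps / M')%R by exact: divr_gt0.
  move=> /cvgrPdist_lt /(_ _ eM) [q _ /(_ q (leqnn q))] /=.
  rewrite sub0r normrN => /(le_lt_trans (ler_norm _)) ?; by exists q.
have qeps1 : ((1 - e) ^+ q * M' <= eps)%R by rewrite -ler_pdivlMr// ltW.
have q0 : (0 <= (1 - e) ^+ q)%R by rewrite exprn_ge0// subr_ge0.
have q1 : ((1 - e) ^+ q <= 1)%R.
  by rewrite exprn_ile1// ?subr_ge0// lerBlDr lerDl ltW.
have qeps2 : ((1 - e) ^+ q <= eps)%R.
  by apply: le_trans qeps1; rewrite ler_peMr.
pose Q := (q * L.+1 + L)%N.
have kQ : keq m (kpow m k Q) (kpow m K q).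
  rewrite /Q -(kpow_mul L q bk).
  exact: (keq_pow q (bistochastic_pow L bk) bK kK).
(* Starting at [Q.+1] leaves at least one factor in [kpow m k r]. Averaging by this left factor
   keeps the bounds already reached, so all large n are covered and not only multiples of [L.+1]. *)
exists Q.+1 => n Qn A B mA mB.
pose r := (n - Q.+1)%N.
have -> : n = (r + Q).+1 by rewrite /r -addnS subnK.
rewrite -(kpow_add r Q bk).
pose G := kprod m (kpow m k r) (kpow m K q).
have bkr := bistochastic_pow r bk.
have bKq := bistochastic_pow q bK.
have [nKq _ _] := bKq.
have kG : keq m (kprod m (kpow m k r) (kpow m k Q)) G.
  exact: (keq_prod bkr bkr (bistochastic_pow Q bk) bKq (@keq_refl _ _ _ m _)
    kQ).
rewrite (kG A B mA mB).
have [nG _ _] : bistochastic m G by exact: bistochastic_prod.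
have a0 : (0 <= 1 - (1 - e) ^+ q)%R by rewrite subr_ge0.
have KqM := kpow_between q _ _ bK (ltW e_gt0) e_le1 KM.
have GM x y : (1 - (1 - e) ^+ q)%:E <= G x y <= (1 + (1 - e) ^+ q * M')%:E.
  apply/andP; split.
    by apply: kprod_ge => // z; have /andP[] := KqM z y.
  by apply: kprod_le => // z; have /andP[] := KqM z y.
have /andP[lo up] := kmass_between nG a0 GM mA mB.
have mAB : 0 <= m A * m B by exact: mule_ge0.
apply/andP; split.
- apply: le_trans lo; apply: lee_wpmul2r => //.
  by rewrite lee_fin lerD2l lerN2.
- apply: le_trans up _; apply: lee_wpmul2r => //.
  by rewrite lee_fin lerD2l.
Qed.

End Balance.

(** * Measure-theoretic complements *)

Section DensityMeasure.
Context {d : measure_display} {T : measurableType d} {R : realType}.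
Variable mu : {measure set T -> \bar R}.
Variable f : T -> \bar R.
Hypotheses (mf : measurable_fun setT f) (f0 : forall x, 0 <= f x)
  (foo : \int[mu]_x f x < +oo).

Let nu A := \int[mu]_(x in A) f x.

Let nu0 : nu set0 = 0. Proof. exact: integral_set0. Qed.

Let nu_ge0 A : 0 <= nu A.
Proof. by apply: integral_ge0 => x _; exact: f0. Qed.

Let nu_sigma_additive : semi_sigma_additive nu.
Proof.
move=> F mF tF mUF; rewrite /nu; apply: cvg_toP.
  apply: ereal_nondecreasing_is_cvgn => m n mn.
  by apply: lee_sum_nneg_natr => // k _ _; exact: nu_ge0.
rewrite ge0_integral_bigcup//.
exact: measurable_funTS.
Qed.

HB.instance Definition _ := isMeasure.Build _ _ _ nu
  nu0 nu_ge0 nu_sigma_additive.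

Let nu_finite : fin_num_fun nu.
Proof.
move=> A mA; rewrite ge0_fin_numE//; apply: le_lt_trans foo.
exact: ge0_subset_integral.
Qed.

HB.instance Definition _ := @Measure_isFinite.Build _ _ _ nu nu_finite.

Lemma density_measure : exists nu : {finite_measure set T -> \bar R},
  forall A, nu A = \int[mu]_(x in A) f x.
Proof. by exists nu. Qed.

End DensityMeasure.

(** The density [f] agrees almost everywhere with the Radon-Nikodym derivative, for which change of
    variables is available. *)
Lemma ge0_integral_density {d : measure_display} {T : measurableType d}
    {R : realType} (mu : {sigma_finite_measure set T -> \bar R})
    (nu : {measure set T -> \bar R}) (f g : T -> \bar R) :
  measurable_fun setT f -> (forall x, 0 <= f x) -> \int[mu]_x f x < +oo ->
  measurable_fun setT g -> (forall x, 0 <= g x) ->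
  (forall A, measurable A -> nu A = \int[mu]_(x in A) f x) ->
  \int[nu]_x g x = \int[mu]_x (g x * f x).
Proof.
move=> mf f0 foo mg g0 nuE; have [nu' nu'E] := density_measure mf f0 foo.
have dom : nu' `<< mu.
  apply/null_content_dominatesP => A mA A0; rewrite nu'E.
  by apply: null_set_integral => //; exact: measurable_funTS.
transitivity (\int[nu']_x g x).
  apply: eq_measure_integral => A mA _.
  exact: (etrans (nuE A mA) (esym (nu'E A))).
rewrite -(Radon_Nikodym_SigmaFinite.change_of_variables dom g0 measurableT mg).
have mrn := measurable_int _ (Radon_Nikodym_SigmaFinite.f_integrable dom).
have rn0 := Radon_Nikodym_SigmaFinite.f_ge0 dom.
apply: ge0_ae_eq_integral => //.
- exact: emeasurable_funM.
- exact: emeasurable_funM.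
- by move=> x _; exact: mule_ge0.
- by move=> x _; exact: mule_ge0.
have : ae_eq mu setT f (Radon_Nikodym_SigmaFinite.f nu' mu).
  apply: integral_ae_eq => //.
  - apply/integrableP; split => //.
    by under eq_integral do rewrite gee0_abs//.
  - move=> A _ mA; apply: (etrans (esym (nu'E A))).
    exact: Radon_Nikodym_SigmaFinite.f_integral.
by apply: filterS => x h /h ->.
Qed.

Section AlmostEverywhere.
Context {d : measure_display} {T : measurableType d} {R : realType}.
Variable mu : {measure set T -> \bar R}.

Import HBNNSimple.

(* No measurability is assumed: the partial derivatives in [copula_prod] take
   junk values where the copula is not differentiable. *)
Lemma ge0_ae_le_integral_nomeas (f g : T -> \bar R) :
  (forall x, 0 <= f x) -> (forall x, 0 <= g x) -> ae_eq mu setT f g ->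
  \int[mu]_x f x <= \int[mu]_x g x.
Proof.
move=> f0 g0 [N [mN N0 fgN]]; rewrite (ge0_integralTE _ f0) (ge0_integralTE _
  g0).
apply: ge_ereal_sup => _ [h /= hf <-].
have mNC : measurable (~` N) by exact: measurableC.
(* Cutting [h] off the null set [N] puts it below [g] everywhere without changing its integral. *)
apply: ereal_sup_ubound; exists (proj_nnsfun h mNC).
  move=> x; change ((h x * \1_(~` N) x)%:E <= g x); rewrite indicE; have
    [xN|xN] := boolP (x \in ~` N); last first.
    by rewrite mulr0; exact: g0.
  rewrite mulr1; have <- : f x = g x; last exact: hf.
  apply: contrapT => fg; move: xN; rewrite inE; apply; apply: fgN => /=.
  by move/(_ Logic.I).
rewrite -!integralT_nnsfun; apply: ge0_ae_eq_integral.
- exact: measurableT.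
- by apply/measurable_EFinP; exact: measurable_funPT.
- by apply/measurable_EFinP; exact: measurable_funPT.
- by move=> x _; rewrite lee_fin; exact: fun_ge0.
- by move=> x _; rewrite lee_fin; exact: fun_ge0.
exists N; split => // x /= /not_implyP[_ hx]; apply: contrapT => xN; apply: hx.
  change ((h x * \1_(~` N) x)%:E = (h x)%:E); by rewrite indicE mem_set ?mulr1.
Qed.

Lemma ae_eq_integral_nomeas (D : set T) (f g : T -> \bar R) :
  ae_eq mu D f g -> \int[mu]_(x in D) f x = \int[mu]_(x in D) g x.
Proof.
move=> fg; rewrite !(integral_mkcond D).
have {}fg : ae_eq mu setT (f \_ D) (g \_ D).
  apply: filterS fg => x h _; rewrite !patchE; case: ifPn => //.
  by rewrite inE => /h.
rewrite integralE [RHS]integralE.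
have /ae_eq_funeposneg[pfg nfg] := fg.
have /ae_eq_funeposneg[pgf ngf] := ae_eq_sym fg.
by congr (_ - _); apply/eqP; rewrite eq_le !ge0_ae_le_integral_nomeas.
Qed.

End AlmostEverywhere.

(** * Iterated integrals over rectangles *)

Section ProductIntegral.
Context {d1 d2 : measure_display} {T1 : measurableType d1}
  {T2 : measurableType d2} {R : realType}.
Variables (m1 : {sigma_finite_measure set T1 -> \bar R})
  (m2 : {sigma_finite_measure set T2 -> \bar R}).
Implicit Types (f : T1 * T2 -> \bar R) (A : set T1) (B : set T2).

Let patchX f A B x y :
  (f \_ (A `*` B)) (x, y) =
  if x \in A then ((fun y => f (x, y)) \_ B) y else 0.
Proof. by rewrite !patchE in_setX; case: (x \in A). Qed.

Let iter_patchX f A B :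
  \int[m1]_x \int[m2]_y (f \_ (A `*` B)) (x, y) =
  \int[m1]_(x in A) \int[m2]_(y in B) f (x, y).
Proof.
rewrite [RHS]integral_mkcond; apply: eq_integral => x _.
rewrite patchE; case: ifPn => xA.
  rewrite [RHS]integral_mkcond; apply: eq_integral => y _.
  by rewrite patchX xA.
rewrite -[RHS](integral0 m2 setT); apply: eq_integral => y _.
by rewrite patchX (negbTE xA).
Qed.

Lemma ge0_integral_setX f A B : measurable_fun setT f -> (forall z, 0 <= f z) ->
  measurable A -> measurable B ->
  \int[m1 \x m2]_(z in A `*` B) f z =
  \int[m1]_(x in A) \int[m2]_(y in B) f (x, y).
Proof.
move=> mf f0 mA mB; have mAB : measurable (A `*` B) by exact: measurableX.
rewrite integral_mkcond fubini_tonelli1; first exact: iter_patchX.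
- apply/(measurable_restrictT _ mAB); exact: measurable_funTS.
- by move=> z; exact: erestrict_ge0.
Qed.

Lemma integral_setX f A B : measurable A -> measurable B ->
  (m1 \x m2).-integrable (A `*` B) f ->
  \int[m1 \x m2]_(z in A `*` B) f z =
  \int[m1]_(x in A) \int[m2]_(y in B) f (x, y).
Proof.
move=> mA mB; have mAB : measurable (A `*` B) by exact: measurableX.
move=> /(integrable_mkcond _ mAB) If.
by rewrite integral_mkcond -(integral12_prod_meas1 If); exact: iter_patchX.
Qed.

End ProductIntegral.

(** * Measures on the plane determined by quadrants *)

Section HalfPlanes.
Context {R : realType}.
Local Notation mR := (measurableTypeR R).

Lemma ray_sigma_algebra (S : set (set mR)) : sigma_algebra setT S ->
  (forall x : R, S `]-oo, x]%classic) -> forall A, measurable A -> S A.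
Proof.
move=> sS rS A; rewrite [measurable](RGenOInfty.measurableE R).
apply: smallest_sub => // _ [x ->].
by rewrite -setCitvl; rewrite -setTD; case: sS => _ + _; apply; exact: rS.
Qed.

Definition quadrants : set (set (mR * mR)) :=
  [set E | exists u v : R, E = `]-oo, u]%classic `*` `]-oo, v]%classic].

(** A half-plane bounded by a ray is a countable union of quadrants; rays generate the Borel sets of
    the line, and A x B is the intersection of the strips A x R and R x B. *)
Lemma measurable_quadrants :
  @measurable _ (mR * mR)%type = <<s quadrants >>.
Proof.
have ssG : sigma_algebra setT <<s quadrants >> by exact: smallest_sigma_algebra.
have [s0 sC sU] := ssG.
have bigT (r : R) : exists n : nat, (r <= n%:R)%R.
  exists (Num.bound `|r|); apply: le_trans (ler_norm r) (ltW _).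
  exact: archi_boundP.
have rayT : \bigcup_n `]-oo, n%:R]%classic = [set: mR].
  apply/seteqP; split => // r _; have [n rn] := bigT r.
  by exists n => //=; rewrite in_itv.
have quadE u v : quadrants (`]-oo, u]%classic `*` `]-oo, v]%classic) by exists
  u, v.
have left (A : set mR) : measurable A -> <<s quadrants >> (A `*` setT).
  apply: (@ray_sigma_algebra (fun A => <<s quadrants >> (A `*` setT))).
  - split => [|B sB|F sF].
    + by rewrite set0X; exact: s0.
    + have -> : (setT `\` B) `*` [set: mR] = setT `\` (B `*` setT).
        apply/seteqP; split => -[x y] /=; first by move=> [[_ ?] _]; split =>
          // -[].
        by move=> [_ h]; split => //; split => // Bx; apply: h.
      exact: sC.
    + by rewrite setX_bigcupl; exact: sU.
  - move=> u; rewrite -rayT setX_bigcupr; apply: sU => n.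
    exact: sub_sigma_algebra.
have right (A : set mR) : measurable A -> <<s quadrants >> (setT `*` A).
  apply: (@ray_sigma_algebra (fun A => <<s quadrants >> (setT `*` A))).
  - split => [|B sB|F sF].
    + by rewrite setX0; exact: s0.
    + have -> : [set: mR] `*` (setT `\` B) = setT `\` (setT `*` B).
        apply/seteqP; split => -[x y] /=; first by move=> [_ [_ ?]]; split =>
          // -[].
        by move=> [_ h]; split => //; split => // Bx; apply: h.
      exact: sC.
    + by rewrite setX_bigcupr; exact: sU.
  - move=> u; rewrite -rayT setX_bigcupl; apply: sU => n.
    exact: sub_sigma_algebra.
apply/seteqP; split; last first.
  apply: smallest_sub; first exact: sigma_algebra_measurable.
  by move=> _ [u [v ->]]; exact: measurableX.
rewrite measurable_prod_measurableType; apply: smallest_sub => //.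
move=> _ [A mA [B mB <-]].
have -> : A `*` B = (A `*` setT) `&` (setT `*` B).
  by rewrite -setXI setIT setTI.
have := @measurableI _ (g_sigma_algebraType quadrants) _ _ (left A mA) (right B
  mB).
by [].
Qed.

Lemma quadrant_measure_unique (m1 m2 : {measure set (mR * mR) -> \bar R}) :
  (forall u v : R, m1 (`]-oo, u]%classic `*` `]-oo, v]%classic) = m2 (`]-oo,
    u]%classic `*` `]-oo, v]%classic)) ->
  (forall u v : R, m1 (`]-oo, u]%classic `*` `]-oo, v]%classic) < +oo) ->
  forall E, measurable E -> m1 E = m2 E.
Proof.
move=> m12 m1oo; apply: (measure_unique quadrants
  (fun n => `]-oo, n%:R]%classic `*` `]-oo, n%:R]%classic)).
- exact: measurable_quadrants.
- move=> _ _ [u [v ->]] [u' [v' ->]]; exists (Num.min u u'), (Num.min v v').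
  rewrite -setXI; congr (_ `*` _); apply/seteqP; split => x /=;
    by rewrite !in_itv/= le_min => /andP.
- by move=> n; exists n%:R, n%:R.
- apply/seteqP; split => // -[x y] _.
  pose r : R := Num.max `|x : R|%R `|y : R|%R.
  exists (Num.bound r) => //=.
  have h : (r < (Num.bound r)%:R)%R.
    by apply: archi_boundP; rewrite le_max normr_ge0.
  rewrite !in_itv/=; split; apply: le_trans (ltW h).
    by rewrite le_max ler_norm.
  by rewrite le_max ler_norm orbT.
- by move=> _ [u [v ->]].
- by move=> n.
Qed.

End HalfPlanes.

(** * Copulas and their densities *)

Section CopulaLaw.
Context {R : realType}.
Local Notation mR := (measurableTypeR R).
Local Notation leb := (@lebesgue_measure R).
Implicit Types (C c : R -> R -> R) (A B : set mR).

Definition unif01 : probability mR R := uniform_prob (@ltr01 R).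

Lemma integral_unif01 (f : mR -> \bar R) A : measurable A ->
  measurable_fun setT f -> (forall x, 0 <= f x) ->
  \int[unif01]_(x in A) f x = \int[leb]_(x in A `&` `[0%R, 1%R]) f x.
Proof.
move=> mA mf f0; rewrite integral_indicl integral_uniform; last 2 first.
- by apply: emeasurable_funM => //; exact/measurable_EFinP.
- by move=> x; rewrite mule_ge0// lee_fin.
rewrite subr0 invr1 mul1e integral_mkcondl; apply: eq_integral => x _.
by rewrite epatch_indic muleC.
Qed.

Lemma unif01_itvC : unif01 (~` `[0%R, 1%R]) = 0.
Proof.
rewrite /unif01 /= /uniform_prob integral_uniform_pdf setIC setICr.
exact: integral_set0.
Qed.

Lemma measurable_unit_square : measurable (unit_square R : set (mR * mR)).
Proof. by apply: measurableX; exact: measurable_itv. Qed.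

Lemma kmass_leb2 (g : mR * mR -> \bar R) A B : measurable_fun setT g ->
  (forall z, 0 <= g z) -> measurable A -> measurable B ->
  kmass unif01 (fun x y => g (x, y)) A B =
  \int[leb \x leb]_(z in (A `*` B) `&` unit_square R) g z.
Proof.
move=> mg g0 mA mB.
have mI : measurable (`[0%R, 1%R]%classic : set mR) by exact: measurable_itv.
have ng : nnkernel (fun x y => g (x, y)).
  split => //; rewrite (_ : (fun _ => _) = g)//.
  by apply/funext => -[].
rewrite /unit_square -setXI.
rewrite (ge0_integral_setX leb leb mg g0 (measurableI _ _ mA mI) (measurableI _
  _ mB mI)).
have mr := measurable_row_integral unif01 ng mB.
have r0 x : 0 <= \int[unif01]_(y in B) g (x, y) by exact: row_integral_ge0 x B
  ng.
rewrite /kmass (integral_unif01 mA mr r0); apply: eq_integral => x _.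
exact: (integral_unif01 mB (nnkernel_row x ng) (fun y => g0 (x, y))).
Qed.

Lemma measure_unit_square (m : {measure set (mR * mR) -> \bar R}) E :
  measurable E -> m (~` unit_square R) = 0 -> m E = m (E `&` unit_square R).
Proof.
move=> mE m0; have mS := measurable_unit_square.
rewrite (measureDI m mE mS) [X in X + _](_ : _ = 0) ?add0e//.
have mD : measurable (E `\` unit_square R) by exact: measurableD.
have mSC : measurable (~` unit_square R : set (mR * mR)) by exact: measurableC.
by apply: (@subset_measure0 _ _ _ m _ _ mD mSC _ m0) => x [].
Qed.

(** A copula is given only at corners in the unit square. Measures carried by the square do not see
    the rest: a quadrant with a negative corner coordinate misses the square, and coordinates above
    1 may be lowered to 1. *)
Lemma unit_quadrant_measure_unique (m1 m2 : {measure set (mR * mR) -> \bar R}) :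
  m1 (~` unit_square R) = 0 -> m2 (~` unit_square R) = 0 -> m1 setT < +oo ->
  (forall u v : R, u \in `[0%R, 1%R] -> v \in `[0%R, 1%R] ->
    m1 (`]-oo, u]%classic `*` `]-oo, v]%classic) =
    m2 (`]-oo, u]%classic `*` `]-oo, v]%classic)) ->
  forall E, measurable E -> m1 E = m2 E.
Proof.
move=> m10 m20 m1oo m12.
have mq (u v : R) : measurable (`]-oo, u]%classic `*` `]-oo, v]%classic : set
  (mR * mR)).
  by apply: measurableX; exact: measurable_itv.
apply: quadrant_measure_unique => u v; last first.
  apply: (le_lt_trans _ m1oo).
  by apply: (@le_measure _ _ _ m1); rewrite ?inE; [exact: mq|exact:
    measurableT|].
have [u0|u0] := ltP u 0%R.
  rewrite (measure_unit_square (mq u v) m10) (measure_unit_square (mq u v) m20).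
  rewrite (_ : _ `&` _ = set0) ?measure0//.
  apply/seteqP; split => // -[x y] [[/= + _] [/= + _]].
  by rewrite !in_itv/= => xu /andP[x0 _]; have := lt_le_trans u0 (le_trans x0
    xu); rewrite ltxx.
have [v0|v0] := ltP v 0%R.
  rewrite (measure_unit_square (mq u v) m10) (measure_unit_square (mq u v) m20).
  rewrite (_ : _ `&` _ = set0) ?measure0//.
  apply/seteqP; split => // -[x y] [[/= _ +] [/= _ +]].
  by rewrite !in_itv/= => xu /andP[x0 _]; have := lt_le_trans v0 (le_trans x0
    xu); rewrite ltxx.
pose u' := Num.min u 1%R; pose v' := Num.min v 1%R.
have qE : (`]-oo, u]%classic `*` `]-oo, v]%classic) `&` unit_square R =
    (`]-oo, u']%classic `*` `]-oo, v']%classic) `&` unit_square R.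
  apply/seteqP; split => -[x y] [[/= xu yv] [/= x1 y1]]; do 2 split => //=;
  move: xu yv x1 y1; rewrite !in_itv/= /u' /v' ?le_min => xu yv /andP[_ x1]
    /andP[_ y1].
  - by rewrite xu x1.
  - by rewrite yv y1.
  - by case/andP: xu.
  - by case/andP: yv.
rewrite (measure_unit_square (mq u v) m10) (measure_unit_square (mq u v) m20)
  qE.
rewrite -(measure_unit_square (mq u' v') m10) -(measure_unit_square (mq u' v')
  m20).
by apply: m12; rewrite in_itv/= /u' /v' le_min ler01 ge_min lexx orbT ?u0 ?v0.
Qed.

(** The conditions of [is_copula] for a bare set function, so that they also apply to the image laws
    of the chain. *)
Definition copula_law C (Q : set (mR * mR) -> \bar R) :=
  [/\ forall A, measurable A -> Q (A `*` setT) = unif01 A,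
      forall B, measurable B -> Q (setT `*` B) = unif01 B &
      forall u v : R, u \in `[0%R, 1%R] -> v \in `[0%R, 1%R] ->
        (C u v)%:E = Q (`]-oo, u]%classic `*` `]-oo, v]%classic)].

Lemma copula_law_unit_square C (Q : {measure set (mR * mR) -> \bar R}) :
  copula_law C Q -> Q (~` unit_square R) = 0.
Proof.
move=> [Q1 Q2 _].
have mI : measurable (~` `[0%R, 1%R]%classic : set mR).
  by apply: measurableC; exact: measurable_itv.
have mIT := measurableX mI (@measurableT _ mR).
have mTI := measurableX (@measurableT _ mR) mI.
have mSC : measurable (~` unit_square R : set (mR * mR)).
  by apply: measurableC; exact: measurable_unit_square.
apply: (@subset_measure0 _ _ _ Q _ _ mSC (measurableU _ _ mIT mTI)).
- move=> [x y] /= nxy.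
  have [xI|xI] := pselect (`[0%R, 1%R]%classic x); last by left.
  by right; split => // yI; apply: nxy.
- apply: null_set_setU => //; first exact: (etrans (Q1 _ mI) unif01_itvC).
  exact: (etrans (Q2 _ mI) unif01_itvC).
Qed.

Lemma copula_law_setT C (Q : {measure set (mR * mR) -> \bar R}) :
  copula_law C Q -> Q setT = 1.
Proof.
by move=> [Q1 _ _]; rewrite -setXTT Q1//; exact: (probability_setT unif01).
Qed.

Definition square_density c : mR * mR -> \bar R :=
  (EFin \o uncurry c) \_ (unit_square R).

(** A density is not assumed nonnegative. Its negative part is moved to the side of [Q], so that two
    genuine measures, [Q] plus f^- and f^+, are compared on quadrants. *)
Lemma density_law C c (Q : {measure set (mR * mR) -> \bar R}) :
  copula_law C Q -> is_density C c ->
  [/\ measurable_fun setT (square_density c),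
      ae_eq (leb \x leb) setT (square_density c)^\- (cst 0) &
      forall E, measurable E ->
        Q E = \int[leb \x leb]_(z in E) (square_density c)^\+ z].
Proof.
move=> lQ [Ic Cc]; set f := square_density c.
have mS := measurable_unit_square.
have If : (leb \x leb).-integrable setT f by apply/(integrable_mkcond _ mS).
have mf : measurable_fun setT f by exact: (measurable_int _ If).
have If1 := integrable_funepos measurableT If.
have If2 := integrable_funeneg measurableT If.
have mf1 := measurable_int _ If1.
have mf2 := measurable_int _ If2.
have f10 z : 0 <= f^\+ z by exact: funepos_ge0.
have f20 z : 0 <= f^\- z by exact: funeneg_ge0.
pose L2 : {measure set (mR * mR)%type -> \bar R} := leb \x leb.
have f1oo : \int[L2]_z f^\+ z < +oo by exact: (integrable_lty measurableT If1).
have f2oo : \int[L2]_z f^\- z < +oo by exact: (integrable_lty measurableT If2).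
have [nu1 nu1E] := @density_measure _ _ _ L2 f^\+ mf1 f10 f1oo.
have [nu2 nu2E] := @density_measure _ _ _ L2 f^\- mf2 f20 f2oo.
have fS z : ~ unit_square R z -> f z = 0.
  by move=> nz; rewrite /f /square_density patchE memNset.
have mSC : measurable (~` unit_square R : set (mR * mR)) by exact: measurableC.
pose n1 : {measure set (mR * mR)%type -> \bar R} := nu1.
pose q2 : {measure set (mR * mR)%type -> \bar R} := measure_add Q nu2.
have n1E E : n1 E = \int[L2]_(z in E) f^\+ z by exact: nu1E.
have q2E E : q2 E = Q E + \int[L2]_(z in E) f^\- z.
  by rewrite -nu2E; exact: measure_addE.
have QE E : measurable E -> q2 E = n1 E.
  apply: unit_quadrant_measure_unique.
  - rewrite q2E (copula_law_unit_square lQ) add0e.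
    by apply: integral0_eq => z /fS fz; rewrite funenegE fz oppe0 maxxx.
  - rewrite n1E.
    by apply: integral0_eq => z /fS fz; rewrite funeposE fz maxxx.
  - rewrite q2E (copula_law_setT lQ).
    by rewrite lte_add_pinfty ?ltry//; exact: integrable_lty If2.
  - move=> u v u01 v01; have [_ _ lC] := lQ.
    rewrite q2E n1E -lC// Cc//.
    set q := _ `*` _.
    have mq : measurable q by apply: measurableX; exact: measurable_itv.
    have <- : \int[leb \x leb]_(z in q) f z =
        \int[leb]_(s in `[0%R, u]) \int[leb]_(t in `[0%R, v]) (c s t)%:E.
      rewrite /f /square_density -integral_mkcondr.
      have -> : q `&` unit_square R = `[0%R, u]%classic `*` `[0%R, v]%classic.
        move: u01 v01; rewrite !in_itv/= => /andP[u0 u1] /andP[v0 v1].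
        apply/seteqP; split => -[x y]; rewrite /q /unit_square /=.
          move=> [[]]; rewrite !in_itv/= => xu yv [] /andP[x0 _] /andP[y0 _].
          by rewrite xu yv x0 y0.
        rewrite !in_itv/= => -[/andP[x0 xu] /andP[y0 yv]].
        by rewrite xu yv x0 y0 (le_trans xu u1) (le_trans yv v1).
      rewrite integral_setX//.
      apply: (integrableS mS) => //.
        by apply: measurableX; exact: measurable_itv.
      move: u01 v01; rewrite !in_itv/= => /andP[u0 u1] /andP[v0 v1].
      move=> [x y] /=; rewrite /unit_square /= !in_itv/= => -[/andP[x0 xu]
        /andP[y0 yv]].
      by rewrite x0 y0 (le_trans xu u1) (le_trans yv v1).
    rewrite integralE subeK//.
    have fn2 : \int[L2]_(z in q) f^\- z \is a fin_num.
      by rewrite -nu2E; exact: fin_num_measure.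
    exact: fn2.
(* On {f < 0} the measure with density f^+ vanishes, hence so does each of the two nonnegative terms
   on the other side. *)
have f2_0 : ae_eq (leb \x leb) setT f^\- (cst 0).
  pose E := [set z | f z < 0].
  have mE : measurable E.
    by rewrite -[E]setTI; exact: emeasurable_fun_infty_o.
  have := QE E mE; rewrite q2E n1E.
  rewrite [RHS]integral0_eq; last first.
    by move=> z Ez; rewrite funeposE; apply/max_idPr; exact: ltW.
  move=> /eqP; rewrite padde_eq0//; last by apply: integral_ge0 => z _; exact:
    f20.
  move=> /andP[_ /eqP E0].
  apply/(ae_eq_integral_abs _ measurableT mf2).
  rewrite -[RHS]E0 [RHS]integral_mkcond; apply: eq_integral => z _.
  rewrite gee0_abs// patchE; case: ifPn => // /negP zE.
  rewrite funenegE; apply/max_idPr; rewrite leeNl oppe0 leNgt.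
  by apply/negP => zE'; apply: zE; rewrite inE.
split => // E mE; have := QE E mE; rewrite q2E n1E => <-.
rewrite [X in _ + X](_ : _ = 0) ?adde0//.
rewrite (ae_eq_integral (cst 0)) ?integral0//.
- exact: measurable_funTS.
- exact: ae_eq_subset f2_0.
Qed.

End CopulaLaw.

(** * From copula densities to bistochastic kernels *)

Section CopulaKernel.
Context {R : realType}.
Local Notation mR := (measurableTypeR R).
Local Notation leb := (@lebesgue_measure R).
Local Notation I := (@unif01 R).
Implicit Types (C c : R -> R -> R) (A B : set mR) (k : mR -> mR -> \bar R).

(** The positive part gives a nonnegative kernel at every point; by [density_law] this alters the
    density only on a null set. *)
Definition density_kernel c : mR -> mR -> \bar R :=
  fun x y => (square_density c)^\+ (x, y).

Lemma nnkernel_density c : measurable_fun setT (square_density c) ->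
  nnkernel (density_kernel c).
Proof.
move=> mc; split => [|x y]; last exact: funepos_ge0.
rewrite (_ : (fun _ => _) = (square_density c)^\+).
  exact: measurable_funepos.
by apply/funext => -[].
Qed.

Lemma kmass_density C c (Q : {measure set (mR * mR)%type -> \bar R}) A B :
  copula_law C Q -> is_density C c -> measurable A -> measurable B ->
  kmass I (density_kernel c) A B = Q (A `*` B).
Proof.
move=> lQ cC mA mB; have [mc _ QE] := density_law lQ cC.
have mAB : measurable (A `*` B) by exact: measurableX.
rewrite (measure_unit_square mAB (copula_law_unit_square lQ)) QE; last first.
  by apply: measurableI => //; exact: measurable_unit_square.
by apply: kmass_leb2 => //; exact: measurable_funepos.
Qed.

Lemma copula_law_unimarginal C k (Q : {measure set (mR * mR)%type -> \bar R}) :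
  copula_law C Q ->
  (forall A B, measurable A -> measurable B -> kmass I k A B = Q (A `*` B)) ->
  unimarginal I k.
Proof.
move=> [Q1 Q2 _] kQ A mA; rewrite !kQ//.
by split; [exact: Q1|exact: Q2].
Qed.

(** All laws of [C] are covered, not just the one that witnesses [is_copula], because the lemma is
    later applied to the image law of two consecutive variables of the chain. *)
Lemma copula_kernel C : is_copula C -> abs_continuous C ->
  exists2 k, bistochastic I k &
    forall (Q : {measure set (mR * mR)%type -> \bar R}), copula_law C Q ->
    forall A B, measurable A -> measurable B -> Q (A `*` B) = kmass I k A B.
Proof.
move=> [Q [Q1 Q2 QC]] [c cC].
have lQ : copula_law C Q by [].
have [mc _ _] := density_law lQ cC.
have nc := nnkernel_density mc.
have uc : unimarginal I (density_kernel c).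
  apply: (copula_law_unimarginal lQ) => A B mA mB.
  exact: (kmass_density lQ cC mA mB).
exists (balance I (density_kernel c)); first exact: bistochastic_balance.
move=> Q' lQ' A B mA mB.
by rewrite -(keq_balance nc uc mA mB) (kmass_density lQ' cC mA mB).
Qed.

(** Supplies a law for a copula power, which is not assumed to be a copula, so that [density_law]
    applies to its densities. *)
Lemma kernel_copula_law C k : bistochastic I k ->
  (forall u v : R, u \in `[0%R, 1%R] -> v \in `[0%R, 1%R] ->
    (C u v)%:E = kmass I k `]-oo, u]%classic `]-oo, v]%classic) ->
  exists2 Q : {measure set (mR * mR)%type -> \bar R}, copula_law C Q &
    forall A B, measurable A -> measurable B -> kmass I k A B = Q (A `*` B).
Proof.
move=> bk Ck; have [nk rk ck] := bk.
have k0 (z : mR * mR) : 0 <= k z.1 z.2 by exact: nk.2.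
have koo : \int[I \x I]_z k z.1 z.2 < +oo.
  rewrite fubini_tonelli1//; last exact: nk.1.
  rewrite /fubini_F /=; under eq_integral do rewrite rk.
  by rewrite integral_prob_cst ltry.
have [nu nuE] := density_measure nk.1 k0 koo.
pose Q : {measure set (mR * mR)%type -> \bar R} := nu.
have QE E : Q E = \int[I \x I]_(z in E) k z.1 z.2 by exact: nuE.
have QkE A B : measurable A -> measurable B -> kmass I k A B = Q (A `*` B).
  by move=> mA mB; rewrite QE ge0_integral_setX//; exact: nk.1.
have uk := bistochastic_unimarginal bk.
exists Q => //; split.
- by move=> A mA; rewrite -QkE//; have [] := uk A mA.
- by move=> A mA; rewrite -QkE//; have [] := uk A mA.
- by move=> u v u01 v01; rewrite -QkE ?Ck//; exact: measurable_itv.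
Qed.

(** The value 1 is written twice, where [p] fails and then by [balance], hence the hypothesis [p 1].
    The maximum with 0 matches the positive part in [density_kernel]. Measurability is taken from
    the genuine density [c0], never from [c]. *)
Lemma density_version_kernel C c k (p : \bar R -> bool) : bistochastic I k ->
  (forall u v : R, u \in `[0%R, 1%R] -> v \in `[0%R, 1%R] ->
    (C u v)%:E = kmass I k `]-oo, u]%classic `]-oo, v]%classic) ->
  is_density_version C c -> measurable_fun setT p -> p 1 ->
  {ae @leb2 R, forall z, unit_square R z -> p (maxe (c z.1 z.2)%:E 0)} ->
  exists k', [/\ bistochastic I k', keq I k k' & forall x y, p (k' x y)].
Proof.
move=> bk Ck [c0 c0C cc0] mp p1 pc.
have [Q lQ kQ] := kernel_copula_law bk Ck.
have [mc _ _] := density_law lQ c0C.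
pose g := density_kernel c0.
have ng : nnkernel g := nnkernel_density mc.
have kg : keq I k g.
  by move=> A B mA mB; rewrite (kQ A B mA mB) (kmass_density lQ c0C mA mB).
pose h x y := if p (g x y) then g x y else 1.
have mh : measurable_fun setT (fun z : mR * mR => h z.1 z.2).
  apply: measurable_fun_ifT => //; last exact: ng.1.
  exact: (measurableT_comp mp ng.1).
have nh : nnkernel h.
  by split => // x y; rewrite /h; case: ifP => // _; exact: ng.2.
have gh : keq I g h.
  move=> A B mA mB.
  have E l : nnkernel l -> kmass I l A B =
      \int[leb \x leb]_(z in (A `*` B) `&` unit_square R) l z.1 z.2.
    move=> nl; rewrite -kmass_leb2//; first exact: nl.1.
    by move=> z; exact: nl.2.
  have mS : measurable ((A `*` B) `&` unit_square R).
    by apply: measurableI; [exact: measurableX|exact: measurable_unit_square].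
  rewrite (E g ng) (E h nh); apply: ge0_ae_eq_integral => //.
  - by apply: measurable_funTS; exact: ng.1.
  - by apply: measurable_funTS; exact: nh.1.
  - by move=> z _; exact: ng.2.
  - by move=> z _; exact: nh.2.
  - have cc1 : {ae (leb \x leb), forall z, unit_square R z ->
        c z.1 z.2 = c0 z.1 z.2} by exact: cc0.
    have pc1 : {ae (leb \x leb), forall z, unit_square R z ->
        p (maxe (c z.1 z.2)%:E 0)} by exact: pc.
    pose L2 : {measure set (mR * mR)%type -> \bar R} := leb \x leb.
    have FL2 : Filter (nbhs (almost_everywhere (leb \x leb))).
      exact: (ae_filter_ringOfSetsType L2).
    apply: filterS2 cc1 pc1 => -[x y] /= cE pcz [_ xy].
    rewrite /h; suff -> : p (g x y) by [].
    rewrite /g /density_kernel funeposE /square_density patchE mem_set//=.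
    by rewrite -cE//; exact: pcz.
have uh : unimarginal I h.
  apply: (keq_unimarginal gh); apply: (keq_unimarginal kg).
  exact: bistochastic_unimarginal.
exists (balance I h); split.
- exact: bistochastic_balance.
- exact: keq_trans kg (keq_trans gh (keq_balance nh uh)).
- by move=> x y; rewrite /balance /h; case: ifP => // _; case: ifP.
Qed.

End CopulaKernel.

(** * Kernel powers as densities of copula powers *)

Section CopulaPower.
Context {R : realType}.
Local Notation mR := (measurableTypeR R).
Local Notation leb := (@lebesgue_measure R).
Local Notation I := (@unif01 R).
Implicit Types (C c : R -> R -> R) (A B : set mR) (k : mR -> mR -> \bar R).

Lemma ae_derive1_integral (a : mR -> \bar R) (G : R -> R) :
  measurable_fun setT a -> (forall x, 0 <= a x) -> (forall x, a x <= 1) ->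
  (forall t : R, t \in `[0%R, 1%R] ->
    (G t)%:E = \int[I]_(x in `]-oo, t]%classic) a x) ->
  ae_eq leb `[0%R, 1%R]%classic (fun t => (derive1 G t)%:E) a.
Proof.
move=> ma a0 a1 Ga.
have mI : measurable (`[0%R, 1%R]%classic : set mR) by exact: measurable_itv.
have afin x : (fine (a x))%:E = a x.
  by rewrite fineK// ge0_fin_numE// (le_lt_trans (a1 x) (ltry 1)).
pose f : R -> R := (fine \o a) \_ `[0%R, 1%R].
have fE : EFin \o f = a \_ `[0%R, 1%R].
  by apply/funext => x; rewrite /f /= !patchE; case: ifPn => //= _; exact: afin.
have If : leb.-integrable setT (EFin \o f).
  rewrite fE; apply/(integrable_mkcond _ mI)/integrableP; split.
    exact: measurable_funTS.
  apply: (@le_lt_trans _ _ (\int[leb]_(x in `[0%R, 1%R]) cst 1 x)).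
    apply: ge0_le_integral => //.
    - by apply: measurable_funTS; exact: measurableT_comp.
    - by move=> x _; rewrite gee0_abs.
  rewrite integral_cst// mul1e.
  by have := @lebesgue_measure_itv R `[0%R, 1%R]; rewrite /= => ->; rewrite
    lte_fin ltr01 sube0 ltry.
have lf : locally_integrable [set: R] f.
  by apply: open_integrable_locally => //; exact: openT.
have Ify (y : R) : leb.-integrable `]-oo, y]%classic (EFin \o f).
  by apply: integrableS If => //; exact: measurable_itv.
have GF (t : R) : t \in `[0%R, 1%R] ->
    G t = (\int[leb]_(x in `]-oo, t]) f x)%R.
  move=> t01; apply: EFin_inj; rewrite Ga// /Rintegral fineK; last first.
    by apply: (integrable_fin_num _ (Ify t)).
  apply: (etrans (integral_unif01 (measurable_itv _) ma a0)).
  rewrite integral_mkcondr; apply: eq_integral => x _.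
  by rewrite -[RHS]/((EFin \o f) x) fE.
(* The endpoints are discarded: the derivative there would involve values of [G] outside [0,1],
   about which nothing is known. At interior points [G] agrees with the integral on a whole
   neighbourhood. *)
have n01 (r : R) : {ae leb, forall x : R, x != r}.
  exists [set r]; split => //; first exact: lebesgue_measure_set1.
  by move=> x /= /negP; rewrite negbK => /eqP.
have Fl : Filter (nbhs (almost_everywhere leb)).
  exact: (ae_filter_ringOfSetsType leb).
have n0 := n01 0%R; have n1 := n01 1%R.
apply: filterS3 n0 n1 (FTC1Ny Ify lf) => t t0 t1 [_ Ft] t01.
have t01' : t \in `]0%R, 1%R[.
  move: t01; rewrite /= !in_itv/= => /andP[? ?].
  by rewrite !lt_neqAle eq_sym t0 t1 /=; apply/andP.
rewrite derive1E (near_eq_derive (g := fun t : R => (\int[leb]_(x in `]-oo,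
  t]%classic) f x)%R : R)); last first.
  have := near_in_itvoo t01'; apply: filterS => s s01; apply: GF.
  exact: subset_itv_oo_cc s01.
by rewrite -derive1E Ft /f patchE mem_set//=; exact: afin.
Qed.

Lemma kmass_le1 k A B : bistochastic I k -> measurable A -> measurable B ->
  kmass I k A B <= 1.
Proof.
move=> bk mA mB; have [nk _ _] := bk; rewrite -[leRHS](integral_prob_cst I).
rewrite /kmass integral_indicl; apply: ge0_le_integral => //.
- by move=> x _; rewrite mule_ge0 ?lee_fin//; exact: row_integral_ge0.
- apply: emeasurable_funM; first exact/measurable_EFinP.
  exact: measurable_row_integral.
- move=> x _; rewrite indicE; case: (x \in A); rewrite ?mul0e ?mul1e//.
  exact: row_integral_le1.
Qed.

(** By induction the two partial derivatives equal [a] and [b] almost everywhere, and integrating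
    a(t) b(t) is [kmass_prod]. The indices differ by one since [kpow I k n] has n + 1 factors. *)
Lemma copula_pow_kmass C k n (u v : R) : bistochastic I k ->
  (forall u v : R, u \in `[0%R, 1%R] -> v \in `[0%R, 1%R] ->
    (C u v)%:E = kmass I k `]-oo, u]%classic `]-oo, v]%classic) ->
  u \in `[0%R, 1%R] -> v \in `[0%R, 1%R] ->
  (copula_pow C n.+1 u v)%:E =
  kmass I (kpow I k n) `]-oo, u]%classic `]-oo, v]%classic.
Proof.
move=> bk Ck; elim: n u v => [|n ih] u v u01 v01; first exact: Ck.
have bn := bistochastic_pow n bk; have [nn _ _] := bn; have [nk _ _] := bk.
have mr (r : R) : measurable (`]-oo, r]%classic : set mR) by exact:
  measurable_itv.
pose a t := \int[I]_(x in `]-oo, u]%classic) kpow I k n x t.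
pose b t := \int[I]_(y in `]-oo, v]%classic) k t y.
have ma : measurable_fun setT a by exact: measurable_col_integral.
have mb : measurable_fun setT b by exact: measurable_row_integral.
have a0 t : 0 <= a t by exact: (row_integral_ge0 I t _ (nnkernel_swap nn)).
have b0 t : 0 <= b t by exact: row_integral_ge0.
have a1 t : a t <= 1 by exact: (row_integral_le1 t (bistochastic_swap bn) (mr
  u)).
have b1 t : b t <= 1 by exact: (row_integral_le1 t bk (mr v)).
have Da := @ae_derive1_integral a (fun t => copula_pow C n.+1 u t) ma a0 a1.
have {}Da : ae_eq leb `[0%R, 1%R]%classic (fun t => (partial2 (copula_pow C
  n.+1) u t)%:E) a.
  apply: Da => t t01; rewrite (ih u t u01 t01) /kmass.
  exact: (fubini_kernel I nn (mr u) (mr t)).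
have Db : ae_eq leb `[0%R, 1%R]%classic (fun t => (partial1 C t v)%:E) b.
  by apply: ae_derive1_integral => // t t01; rewrite Ck.
rewrite -[copula_pow C n.+2]/(copula_prod (copula_pow C n.+1) C).
rewrite /copula_prod /Rintegral.
have -> : \int[leb]_(t in `[0%R, 1%R])
    (partial2 (copula_pow C n.+1) u t * partial1 C t v)%:E =
    kmass I (kpow I k n.+1) `]-oo, u]%classic `]-oo, v]%classic.
  have mab : measurable_fun setT (fun t => a t * b t) by exact:
    emeasurable_funM.
  have ab0 t : 0 <= a t * b t by exact: mule_ge0.
  rewrite kpowS (kmass_prod I nn nk (mr u) (mr v)).
  apply: (etrans _ (esym (integral_unif01 measurableT mab ab0))).
  rewrite setTI; apply: ae_eq_integral_nomeas.
  have Fl : Filter (nbhs (almost_everywhere leb)).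
    exact: (ae_filter_ringOfSetsType leb).
  by apply: filterS2 Da Db => t ha hb t01; rewrite EFinM ha// hb.
have bn1 := bistochastic_pow n.+1 bk; have [nn1 _ _] := bn1.
rewrite fineK// ge0_fin_numE; last first.
  by apply: integral_ge0 => x _; exact: row_integral_ge0.
exact: (le_lt_trans (kmass_le1 bn1 (mr u) (mr v)) (ltry 1)).
Qed.

End CopulaPower.

(** * The joint laws of the chain *)

Section ChainLaw.
Context {R : realType} {d : measure_display} {T : measurableType d}.
Variable P : probability T R.
Local Notation mR := (measurableTypeR R).
Local Notation I := (@unif01 R).

Lemma pushforward_measure {d' : measure_display} {X : measurableType d'}
    (m : {measure set T -> \bar R}) (f : T -> X) : measurable_fun setT f ->
  exists Q : {measure set X -> \bar R}, forall E, Q E = m (f @^-1` E).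
Proof.
move=> mf; pose Q : {measure set X -> \bar R} := pushforward m f.
by exists (Q mf).
Qed.

Lemma lt_null_of_integral_eq (f g : T -> R) :
  P.-integrable setT (EFin \o f) -> P.-integrable setT (EFin \o g) ->
  measurable [set x | (f x < g x)%R] ->
  \int[P]_(x in [set x | (f x < g x)%R]) (f x)%:E =
  \int[P]_(x in [set x | (f x < g x)%R]) (g x)%:E ->
  P [set x | (f x < g x)%R] = 0.
Proof.
set D := [set x | _] => If Ig mD fg.
have IfD : P.-integrable D (EFin \o f) by exact: integrableS If.
have IgD : P.-integrable D (EFin \o g) by exact: integrableS Ig.
have mgf : measurable_fun D (fun x => (g x)%:E - (f x)%:E).
  by apply: emeasurable_funB; [exact: measurable_int IgD|exact: measurable_int
    IfD].
have gf0 : \int[P]_(x in D) `|(g x)%:E - (f x)%:E| = 0.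
  transitivity (\int[P]_(x in D) ((g x)%:E - (f x)%:E)).
    apply: eq_integral => x; rewrite inE => fgx.
    by rewrite gee0_abs// -EFinB lee_fin subr_ge0 ltW.
  rewrite integralB_EFin// fg subee//.
  exact: (integrable_fin_num mD IgD).
have [+ _] := ae_eq_integral_abs P mD mgf.
move=> /(_ gf0) [N [mN N0 DN]].
apply: (subset_measure0 mD mN _ N0) => x Dx; apply: DN => /= /(_ Dx) /eqP.
by rewrite -EFinB eqe subr_eq0 gt_eqF.
Qed.

Variables (U : nat -> {RV P >-> R}) (C : R -> R -> R) (k : mR -> mR -> \bar R).
Hypotheses (bk : bistochastic I k)
  (kQ : forall (Q : {measure set (mR * mR)%type -> \bar R}), copula_law C Q ->
    forall A B, measurable A -> measurable B -> Q (A `*` B) = kmass I k A B)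
  (chU : is_chain_of C U).

Let mU n : measurable_fun setT (U n : T -> mR).
Proof.
have mUn : measurable_fun setT (U n) by exact: measurable_funPT.
exact: mUn.
Qed.

Let mUpre n (A : set mR) : measurable A -> measurable (U n @^-1` A).
Proof. by move=> mA; rewrite -[_ @^-1` _]setTI; exact: mU. Qed.

Let PU n (A : set mR) : measurable A -> P (U n @^-1` A) = I A.
Proof. by move=> mA; have [_ _ + _] := chU; exact. Qed.

(** The chain prescribes this law on quadrants only; together with the uniform marginals it is a law
    of [C], and [kQ] extends the identity to all rectangles. *)
Lemma chain_step_law n (A B : set mR) : measurable A -> measurable B ->
  P (U n @^-1` A `&` U n.+1 @^-1` B) = kmass I k A B.
Proof.
move=> mA mB.
have mUU : measurable_fun setT (fun x => (U n x, U n.+1 x) : mR * mR).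
  by apply/measurable_fun_pairP; split; exact: mU.
have [Q QE] := pushforward_measure P mUU.
have lQ : copula_law C Q.
  split.
  - move=> A' mA'; rewrite QE -(PU n mA'); congr (P _).
    by apply/seteqP; split => x //= [].
  - move=> A' mA'; rewrite QE -(PU n.+1 mA'); congr (P _).
    by apply/seteqP; split => x //= [].
  - by move=> u v u01 v01; have [_ _ _ UC] := chU; rewrite QE -(UC n).
by rewrite -(kQ lQ mA mB) QE.
Qed.

(** The transition probability from z into [B]. *)
Let b (B : set mR) z := \int[I]_(y in B) k z y.

Let b_bounds B z : measurable B -> 0 <= b B z <= 1.
Proof.
move=> mB; have [nk _ _] := bk; apply/andP; split.
  exact: row_integral_ge0.
exact: row_integral_le1.
Qed.

Let mb B : measurable B -> measurable_fun setT (b B).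
Proof. by move=> mB; have [nk _ _] := bk; exact: measurable_row_integral. Qed.

Let integral_b n (A B : set mR) : measurable A -> measurable B ->
  \int[P]_(x in U n @^-1` A) b B (U n x) = P (U n.+1 @^-1` B `&` U n @^-1` A).
Proof.
move=> mA mB; rewrite setIC chain_step_law// /kmass.
have b0 : {in A, forall y, 0 <= b B y}.
  by move=> y _; have /andP[] := b_bounds y mB.
rewrite -(ge0_integral_pushforward (mU n) P mA (measurable_funTS (mb mB)) b0).
apply: eq_measure_integral => E mE _; exact: (PU n mE).
Qed.

Let sigma_of1 n E : sigma_of U [set n] E ->
  exists2 A : set mR, measurable A & E = U n @^-1` A.
Proof.
rewrite /sigma_of bigcup_set1 => sE.
have : preimage_set_system setT (U n) (@measurable _ mR) E.
  move: E sE; apply: smallest_sub => //.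
  by apply: sigma_algebra_preimage; exact: sigma_algebra_measurable.
by move=> [A mA <-]; exists A => //; rewrite setTI.
Qed.

Let sigma_of_pre (J : set nat) n (A : set mR) : J n -> measurable A ->
  sigma_of U J (U n @^-1` A).
Proof.
move=> Jn mA; apply: sub_sigma_algebra; exists n => //.
by exists A => //; rewrite setTI.
Qed.

(** Uniqueness of conditional probabilities: [f] and [b B (U n x)] are measurable for the
    sigma-algebra of [U n] and have equal integrals over its sets, in particular over the two sets
    where one exceeds the other. *)
Let cond_prob_b n (B : set mR) f : measurable B ->
  is_cond_prob P (sigma_of U [set n]) (U n.+1 @^-1` B) f ->
  ae_eq P setT (EFin \o f) (fun x => b B (U n x)).
Proof.
move=> mB [mf If fE].
pose g x := fine (b B (U n x)).
have gE x : (g x)%:E = b B (U n x).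
  rewrite /g fineK// ge0_fin_numE; have /andP[b0 b1] := b_bounds (U n x) mB =>
    //.
  exact: (le_lt_trans b1 (ltry 1)).
have mbU : measurable_fun setT (fun x => b B (U n x)).
  exact: (measurableT_comp (mb mB) (mU n)).
have mg : measurable_fun setT g.
  by apply/measurable_EFinP; rewrite (_ : EFin \o g = fun x => b B (U n x))//;
    apply/funext.
have Ig : P.-integrable setT (EFin \o g).
  apply: measurable_bounded_integrable => //.
    exact: (le_lt_trans (probability_le1 P measurableT) (ltry 1)).
  exists 1%R; split => // M M1 x _ /=; rewrite ger0_norm ?fine_ge0//.
    by rewrite (le_trans _ (ltW M1))// -lee_fin gE; have /andP[] := b_bounds (U
      n x) mB.
  by have /andP[] := b_bounds (U n x) mB.
have gint E : sigma_of U [set n] E -> \int[P]_(x in E) (f x)%:E = \int[P]_(x in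
  E) (g x)%:E.
  move=> sE; rewrite fE//; have [A mA ->] := sigma_of1 sE.
  by rewrite -integral_b//; apply: eq_integral => x _; rewrite gE.
(* The sample space with the smaller sigma-algebra of [U n]: the comparison sets must be measurable
   there, not merely in [T]. *)
pose T' := g_sigma_algebraType
  (\bigcup_(i in [set n]) preimage_set_system setT (U i) measurable).
have mf' : measurable_fun (setT : set T') f.
  by move=> _ B' mB'; rewrite setTI; exact: mf.
have mg' : measurable_fun (setT : set T') g.
  move=> _ B' mB'; rewrite setTI.
  have -> : g @^-1` B' = U n @^-1` ((fine \o b B) @^-1` B') by [].
  apply: sigma_of_pre => //; rewrite -[_ @^-1` _]setTI.
  by apply: (measurableT_comp (fine_measurable measurableT) (mb mB)).
have slt (f1 f2 : T' -> R) : measurable_fun setT f1 -> measurable_fun setT f2 ->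
    sigma_of U [set n] [set x | (f1 x < f2 x)%R].
  move=> m1 m2; have := measurable_fun_ltr m1 m2 measurableT (Y := [set true])
    Logic.I.
  by rewrite setTI.
have sm E : sigma_of U [set n] E -> measurable E.
  by move=> /sigma_of1 [A mA ->]; exact: mUpre.
have s1 := slt _ _ mf' mg'; have s2 := slt _ _ mg' mf'.
have P1 := lt_null_of_integral_eq If Ig (sm _ s1) (gint _ s1).
have P2 := lt_null_of_integral_eq Ig If (sm _ s2) (esym (gint _ s2)).
exists ([set x | (f x < g x)%R] `|` [set x | (g x < f x)%R]); split.
- by apply: measurableU; exact: sm.
- exact: (null_set_setU (sm _ s1) (sm _ s2) P1 P2).
- move=> x /= /not_implyP[_]; rewrite -gE => fgx.
  by have [?|?|fg] := ltgtP (f x) (g x); [left|right|case: fgx; rewrite fg].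
Qed.

Theorem chain_law n (A B : set mR) : measurable A -> measurable B ->
  P (U 0%N @^-1` A `&` U n.+1 @^-1` B) = kmass I (kpow I k n) A B.
Proof.
elim: n A B => [|n ih] A B mA mB; first exact: chain_step_law.
have [mkU _ _ _] := chU.
(* The Markov property gives one [f] for both sigma-algebras: [cf1] identifies it with the
   transition probability, and [cf2] allows integrating it over an event about [U 0]. *)
have [f cf1 cf2] := mkU n.+1 B mB.
have fb := cond_prob_b mB cf1; have [_ If _] := cf1.
have [_ _ cf2E] := cf2.
have mA0 := mUpre 0 mA.
have mbU : measurable_fun setT (fun x => b B (U n.+1 x)).
  exact: (measurableT_comp (mb mB) (mU n.+1)).
have b0 z : 0 <= b B z by have /andP[] := b_bounds z mB.
rewrite setIC -cf2E; last exact: sigma_of_pre.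
have bn := bistochastic_pow n bk; have [nn _ _] := bn; have [nk _ _] := bk.
pose a z := \int[I]_(x in A) kpow I k n x z.
have ma : measurable_fun setT a by exact: measurable_col_integral.
have a0 z : 0 <= a z by exact: (row_integral_ge0 I z _ (nnkernel_swap nn)).
have a1 z : a z <= 1 by exact: (row_integral_le1 z (bistochastic_swap bn) mA).
have aoo : \int[I]_z a z < +oo.
  apply: (@le_lt_trans _ _ (\int[I]_z cst 1 z)).
    by apply: ge0_le_integral.
  by rewrite integral_prob_cst ltry.
(* [e] is the density of the measure E -> P(U_0 in A, E). By the induction hypothesis, the image of
   this measure under [U n.+1] has density [a] with respect to [I]; the wanted probability is then
   the integral of a b. *)
pose e x : \bar R := (\1_(U 0%N @^-1` A) x)%:E.
have me : measurable_fun setT e by exact/measurable_EFinP/measurable_indic.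
have e0 x : 0 <= e x by rewrite lee_fin.
have eE E : measurable E -> \int[P]_(x in E) e x = P (U 0%N @^-1` A `&` E).
  by move=> mE; rewrite integral_indic.
have eoo : \int[P]_x e x < +oo.
  rewrite eE// setIT; exact: (le_lt_trans (probability_le1 P mA0) (ltry 1)).
have [nu nuE] := density_measure me e0 eoo.
have [Q QE] := pushforward_measure nu (mU n.+1).
transitivity (\int[P]_x (b B (U n.+1 x) * e x)).
  transitivity (\int[P]_(x in U 0%N @^-1` A) b B (U n.+1 x)).
    apply: ae_eq_integral => //.
    - by apply: measurable_funTS; exact: (measurable_int _ If).
    - exact: measurable_funTS.
    - exact: ae_eq_subset fb.
  by rewrite integral_indicl; apply: eq_integral => x _; rewrite muleC.
rewrite -(@ge0_integral_density _ _ _ P nu e _ me e0 eoo mbU (fun x => b0 (U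
  n.+1 x)) (fun E _ => nuE E)).
transitivity (\int[Q]_z b B z).
  have b0' : {in setT, forall y, 0 <= b B y} by move=> y _; exact: b0.
  rewrite -[LHS]/(\int[nu]_(x in U n.+1 @^-1` setT) (b B \o U n.+1) x).
  rewrite -(ge0_integral_pushforward (mU n.+1) nu measurableT (mb mB) b0').
  by apply: eq_measure_integral => E mE _; rewrite QE.
rewrite (@ge0_integral_density _ _ _ I Q a _ ma a0 aoo (mb mB) b0); last first.
  move=> E mE; rewrite QE; apply: (etrans (nuE _)).
  rewrite (eE _ (mUpre n.+1 mE)) (ih A E mA mE) /kmass.
  exact: (fubini_kernel I nn mA mE).
rewrite kpowS (kmass_prod I nn nk mA mB).
by apply: eq_integral => z _; rewrite muleC.
Qed.

End ChainLaw.

(** * From bounds on rectangles to the psi coefficient *)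

Section PsiMixing.
Context {R : realType} {d : measure_display} {T : measurableType d}.
Variables (P : probability T R) (U : nat -> {RV P >-> R}).

(** The supremum needs an admissible pair, as it would be -oo over the empty set; the whole line
    taken twice is one. *)
Lemma psi_coef_ge0 n : 0 <= psi_coef U n.
Proof.
apply: (@le_trans _ _ (psi_ratio U n setT setT)%:E).
  by rewrite lee_fin /psi_ratio; apply: divr_ge0 => //; apply: mulr_ge0;
    apply: fine_ge0; exact: measure_ge0.
apply: ereal_sup_ubound; exists setT, setT; split => //.
rewrite preimage_setT; have -> : P [set: T] = 1 by exact: probability_setT.
by rewrite mule1 lte_fin ltr01.
Qed.

Lemma psi_ratio_le n (A B : set R) (eps : R) :
  measurable A -> measurable B ->
  0 < P (U 0%N @^-1` A) * P (U 0%N @^-1` B) ->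
  (1 - eps)%:E * (P (U 0%N @^-1` A) * P (U 0%N @^-1` B)) <=
    P (U 0%N @^-1` A `&` U n @^-1` B) <=
  (1 + eps)%:E * (P (U 0%N @^-1` A) * P (U 0%N @^-1` B)) ->
  (psi_ratio U n A B <= eps)%R.
Proof.
move=> mA mB; rewrite /psi_ratio.
have mU i (D : set R) : measurable D -> measurable (U i @^-1` D).
  move=> mD; have mUi : measurable_fun setT (U i) by exact: measurable_funPT.
  by rewrite -[_ @^-1` _]setTI; exact: mUi.
have fin E : measurable E -> P E = (fine (P E))%:E.
  by move=> mE; rewrite fineK//; exact: fin_num_measure.
rewrite (fin _ (mU 0%N A mA)) (fin _ (mU 0%N B mB)).
rewrite (fin _ (measurableI _ _ (mU 0%N A mA) (mU n B mB))) /=.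
rewrite -EFinM -!EFinM lte_fin !lee_fin => ab0 /andP[lo up].
by rewrite ler_pdivrMr// ler_norml; apply/andP; split; lra.
Qed.

Lemma psi_mixing_of_ratio :
  (forall eps : R, (0 < eps)%R -> exists N, forall n, (N <= n)%N ->
   forall A B : set R, measurable A -> measurable B ->
   0 < P (U 0%N @^-1` A) * P (U 0%N @^-1` B) -> (psi_ratio U n A B <= eps)%R) ->
  psi_mixing U.
Proof.
move=> H.
have psi_le (eps : R) : (0 < eps)%R ->
    exists N, forall n, (N <= n)%N -> psi_coef U n <= eps%:E.
  move=> /H [N HN]; exists N => n Nn; apply: ge_ereal_sup => _ [A [B [mA mB AB
    ->]]].
  by rewrite lee_fin; exact: HN.
rewrite /psi_mixing; apply/fine_cvgP; split.
  have [N HN] := psi_le 1%R ltr01; exists N => // n /= Nn.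
  by rewrite ge0_fin_numE ?psi_coef_ge0// (le_lt_trans (HN n Nn) (ltry 1)).
apply/cvgrPdist_le => eps eps0; have [N HN] := psi_le eps eps0.
exists N => // n /= Nn; rewrite sub0r normrN ger0_norm ?fine_ge0
  ?psi_coef_ge0//.
have := HN n Nn; have := psi_coef_ge0 n.
by case: (psi_coef U n) => [r| |] //; rewrite lee_fin.
Qed.

End PsiMixing.

(** The square itself has measure 1, so a subset of measure 1 omits only a null part of it. *)
Lemma ae_unit_square {R : realType} (A : set (R * R)) (p : R * R -> Prop) :
  measurable (A : set (measurableTypeR R * measurableTypeR R)%type) ->
  A `<=` unit_square R -> leb2 A = 1 -> (forall z, A z -> p z) ->
  {ae @leb2 R, forall z, unit_square R z -> p z}.
Proof.
move=> mA AS A1 Ap.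
pose L2 : {measure set (measurableTypeR R * measurableTypeR R)%type -> \bar R}
  :=
  (@lebesgue_measure R \x @lebesgue_measure R).
have mS := @measurable_unit_square R.
have leb01 : @lebesgue_measure R `[0%R, 1%R] = 1.
  have := @lebesgue_measure_itv R `[0%R, 1%R]; rewrite /= => ->.
  by rewrite lte_fin ltr01 sube0.
have S1 : L2 (unit_square R) = 1.
  have mI : measurable (`[0%R, 1%R]%classic : set (measurableTypeR R)).
    exact: measurable_itv.
  apply: (etrans (product_measure1E _ _ mI mI)).
  by rewrite -[RHS]mule1; congr (_ * _); exact: leb01.
exists (unit_square R `\` A); split.
- exact: measurableD.
- rewrite -[LHS]/(L2 (unit_square R `\` A)).
  have S1oo : L2 (unit_square R) < +oo by rewrite S1 ltry.
  apply: (etrans (measureD mS mA S1oo)); rewrite (setIidr AS).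
  transitivity (1 - 1 : \bar R); last by rewrite subee.
  by congr (_ - _); [exact: S1|exact: A1].
- move=> z /= /not_implyP[Sz npz]; split => // Az; apply: npz; exact: Ap.
Qed.

Local Close Scope ereal_scope.

Theorem theorem3p1 (R : realType) (C : R -> R -> R)
  (copC : is_copula C) (acC : abs_continuous C)
  (s1 s2 : nat) (s1_gt0 : (0 < s1)%N) (s2_gt0 : (0 < s2)%N)
  (c1 c2 : R -> R -> R)
  (c1_version : is_density_version (copula_pow C s1) c1)
  (c2_version : is_density_version (copula_pow C s2) c2)
  (cond :
    (exists M : R,
      (exists2 A : set (R * R),
        [/\ measurable A, A `<=` unit_square R & leb2 A = 1%E] &
        forall z, A z -> 0 < c1 z.1 z.2) /\
      (forall u v, u \in `[0, 1] -> v \in `[0, 1] -> c2 u v < M))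
    \/
    (exists M : R, M <= 2 /\
      (forall u v, u \in `[0, 1] -> v \in `[0, 1] -> c2 u v < M))) :
  generates_psi_mixing C.
Proof.
have [k bk kQ] := copula_kernel copC acC.
have Ck (u v : R) : u \in `[0, 1] -> v \in `[0, 1] ->
    (C u v)%:E = kmass (@unif01 R) k `]-oo, u]%classic `]-oo, v]%classic.
  have [Q [Q1 Q2 QC]] := copC.
  have lQ : copula_law C Q by [].
  by move=> u01 v01; rewrite QC// (kQ _ lQ)//; exact: measurable_itv.
(* The predecessor appears because [kpow] with index n has n + 1 factors. *)
pose kn s := kpow (@unif01 R) k s.-1.
have version s c (p : \bar R -> bool) : (0 < s)%N ->
    is_density_version (copula_pow C s) c -> measurable_fun setT p -> p 1%E ->
    {ae @leb2 R, forall z, unit_square R z -> p (maxe (c z.1 z.2)%:E 0%E)} ->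
    exists k', [/\ bistochastic (@unif01 R) k', keq (@unif01 R) (kn s) k' &
      forall x y, p (k' x y)].
  move=> s0 cv mp p1 pc.
  apply: density_version_kernel cv mp p1 pc; first exact: bistochastic_pow.
  by move=> u v u01 v01; rewrite -(copula_pow_kmass _ bk Ck u01 v01) prednK.
(* 1 < M because the modified kernel takes the value 1 on the exceptional set. *)
have bounded (M : R) : 1 < M ->
    (forall u v, u \in `[0, 1] -> v \in `[0, 1] -> c2 u v < M) ->
    exists k2, [/\ bistochastic (@unif01 R) k2, keq (@unif01 R) (kn s2) k2 &
      forall x y, (k2 x y < M%:E)%E].
  move=> M1 c2M.
  apply: (version s2 c2 (fun y => (y < M%:E)%E)) => //.
  - exact: measurable_fun_lte.
  - exists set0; split => // z /= /not_implyP[[z1 z2]]; case.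
    by rewrite gt_max lte_fin lte_fin (lt_trans ltr01 M1) c2M.
suff [k1 [k2 [i [j [M [bk1 bk2 k10 [k2M kk1 kk2]]]]]]] :
    exists k1 k2 i j, exists M : R,
    [/\ bistochastic (@unif01 R) k1, bistochastic (@unif01 R) k2,
        forall x y, (0 < k1 x y)%E &
        [/\ forall x y, (k2 x y <= M%:E)%E,
            keq (@unif01 R) (kpow (@unif01 R) k i) k1 &
            keq (@unif01 R) (kpow (@unif01 R) k j) k2]].
  move=> d T P U chU; apply: psi_mixing_of_ratio => eps eps0.
  have [N HN] := kpow_mixing bk bk1 bk2 k10 k2M kk1 kk2 eps0.
  (* [chain_law] at n concerns time n + 1, hence the shift of the threshold. *)
  exists N.+1 => -[//|n] Nn A B mA mB AB; apply: psi_ratio_le => //.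
  have [_ _ Ulaw _] := chU.
  have UE (D : set R) : measurable D -> P (U 0%N @^-1` D) = @unif01 R D.
    by move=> mD; exact: Ulaw.
  by rewrite (UE A mA) (UE B mB) (chain_law bk kQ chU n mA mB); exact: HN.
case: cond => [[M [[A [mA AS A1] c1A] c2M]]|[M [M2 c2M]]].
- have [k1 [bk1 kk1 k10]] : exists k1, [/\ bistochastic (@unif01 R) k1,
      keq (@unif01 R) (kn s1) k1 & forall x y, (0 < k1 x y)%E].
    apply: (version s1 c1 (fun y => (0 < y)%E)) => //.
    + exact: measurable_fun_lte.
    + apply: (ae_unit_square (A := A)) => // z Az.
      by rewrite lt_max lte_fin c1A.
  (* Enlarged to lie strictly above 1, as [bounded] requires. *)
  pose M' := Num.max M 1 + 1.
  have MM' : M < M'.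
    by apply: (@le_lt_trans _ _ (Num.max M 1)); rewrite ?ltrDl// le_max lexx.
  have M'1 : 1 < M'.
    by apply: (@le_lt_trans _ _ (Num.max M 1)); rewrite ?ltrDl// le_max lexx
      orbT.
  have [k2 [bk2 kk2 k2M]] := bounded M' M'1
    (fun u v hu hv => lt_trans (c2M u v hu hv) MM').
  exists k1, k2, s1.-1, s2.-1, M'; split; [exact: bk1|exact: bk2|exact: k10|].
  by split; [move=> x y; exact: ltW|exact: kk1|exact: kk2].
- have [k2 [bk2 kk2 k2M]] := bounded 2 (ltr1n _ 2)
    (fun u v hu hv => lt_le_trans (c2M u v hu hv) M2).
  have bkn := bistochastic_pow s2.-1 bk.
  (* The square of [k2] is the positive kernel; it represents the power 2 s2 of the copula, whose
     index in [kpow] is 2 s2 - 1. *)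
  exists (kprod (@unif01 R) k2 k2), k2, (s2.-1 + s2.-1).+1, s2.-1, 2; split.
  + exact: bistochastic_prod.
  + exact: bk2.
  + by move=> x y; exact: complement_product.
  + split; [by move=> x y; exact: ltW| |exact: kk2].
    rewrite -(kpow_add _ _ bk); exact: (keq_prod bkn bk2 bkn bk2 kk2 kk2).
Qed.
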